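(* Let $a>0$ and let $\lambda:E\to[0,\infty)$ be continuous, with $\lambda^\pm(y)=\lambda(y,\pm1)$. Suppose there exist constants $y_0\ge0$ and $\lambda_{\min}>0$ such that, for $y\in\mathbb{R}$ and $j\in\{-1,+1\}$, (i) $\lambda(y,j)\ge\lambda_{\min}$ for $jy\ge y_0$, and (ii) $\lambda(y,-j)\le\lambda(y,j)$ for $jy\ge y_0$. Let $\Psi:\mathbb{R}\to\mathbb{R}$ be defined by $$\Psi(y)=\frac1a\int_0^y\{\lambda^+(\eta)-\lambda^-(\eta)\}\,d\eta,\quad y\in\mathbb{R}.$$ Then $\Psi$ is bounded from below, $\Psi(y)<\infty$ for all $y\in\mathbb{R}$, and the zig-zag Markov process $(Y,J)$ with speed $a$ and switching rate $\lambda$ has invariant measure $\mu$ with density $(y,j)\mapsto\exp(-\Psi(y))$ with respect to $\mathrm{Leb}\otimes(\delta_{-1}+\delta_{+1})$ on $E$.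
   Context: $E=\mathbb{R}\times\{-1,+1\}$ with the product topology. The measure $\mu$ is not required to be finite. For $(y,j)\in E$ let $F(t;y,j)=\exp\left(-\int_0^t\lambda(y+ajs,j)\,ds\right)$, $t\ge0$. The zig-zag process $(Y(t),J(t))$ started from $(y,j)$, with law $\mathbb{P}_{y,j}$, is defined as follows: $T_0=0$, $Y(0)=y$, $J(0)=j$; for $i=1,2,\dots$, $Z_i$ is a random variable with $\mathbb{P}_{y,j}(Z_i>t\mid Z_1,\dots,Z_{i-1})=F(t;Y(T_{i-1}),J(T_{i-1}))$, $T_i=T_{i-1}+Z_i$, $J(t)=J(T_{i-1})$ for $T_{i-1}<t<T_i$, $J(T_i)=-J(T_{i-1})$, and $Y(t)=Y(T_{i-1})+J(T_{i-1})a(t-T_{i-1})$ for $T_{i-1}<t\le T_i$. Under the hypotheses, $T_k\to\infty$ almost surely, so the process is defined for all times. *)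

(* Defs.v *)
From HB Require Import structures.
From mathcomp Require Import all_boot all_order all_algebra.
From mathcomp Require Import all_classical all_reals all_analysis.
From mathcomp Require Import measurable_realfun.

Set Implicit Arguments.
Unset Strict Implicit.
Unset Printing Implicit Defensive.

Import Order.TTheory GRing.Theory Num.Theory.
Import numFieldNormedType.Exports.

Local Open Scope classical_set_scope.
Local Open Scope ring_scope.

(* The space R x {-1,+1}: [true] stands for +1, [false] for -1 and negation of
   booleans for j |-> -j. [bool] carries the discrete topology and
   sigma-algebra, so E carries the product topology and its Borel sets. *)
Notation zzspace R := ((R : realType) * bool)%type.

Definition sgn {R : realType} (j : bool) : R := if j then 1 else -1.

Definition sign_measure (R : realType) : set bool -> \bar R :=
  measure_add \d_false \d_true.

HB.instance Definition _ (R : realType) := Measure.on (@sign_measure R).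

Lemma sign_measure_fin (R : realType) : fin_num_fun (@sign_measure R).
Proof. by move=> A mA; rewrite /sign_measure measure_addE fin_numD !fin_num_measure. Qed.

HB.instance Definition _ (R : realType) :=
  @Measure_isFinite.Build _ _ R (@sign_measure R) (@sign_measure_fin R).

(* [\int_0^y f] for y of either sign. *)
Definition integral_from0 {R : realType} (f : R -> R) (y : R) : \bar R :=
  (if (0 <= y)%R then \int[lebesgue_measure]_(x in `[0%R, y]) (f x)%:E
   else - \int[lebesgue_measure]_(x in `[y, 0%R]) (f x)%:E)%E.

(* Kept extended-real-valued so that finiteness is a genuine claim. *)
Definition Psi {R : realType} (a : R) (lambda : zzspace R -> R) (y : R) : \bar R :=
  ((a^-1)%:E *
   integral_from0 (fun eta => lambda (eta, true) - lambda (eta, false))%R y)%E.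

Definition survival {R : realType} (a : R) (lambda : zzspace R -> R)
    (t : R) (x : zzspace R) : R :=
  expR (- \int[lebesgue_measure]_(s in `[0, t])
            lambda (x.1 + a * sgn x.2 * s, x.2)).

(* [G] is a version of the conditional probability of the event [A] given the
   sub-sigma-algebra [S]. *)
Definition is_cond_prob d (T : measurableType d) (R : realType)
    (P : probability T R) (S : set (set T)) (A : set T) (G : T -> R) : Prop :=
  (forall B : set R, measurable B -> S (G @^-1` B)) /\
  (forall C, S C -> P (A `&` C) = (\int[P]_(w in C) (G w)%:E)%E).

Definition jump_time {R : realType} (T : Type) (Z : nat -> T -> R) (n : nat) (w : T) : R :=
  \sum_(k < n) Z k w.

(* A realization of the zig-zag process with speed [a] and switching rate
   [lambda] started from [x]. [zz_Z i] is the (i+1)-st holding time, so that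
   [jump_time zz_Z i] is T_i. Times t < 0 and, on the event that the T_i stay
   bounded, times beyond sup T_i are left unconstrained. *)
Record zigzag {R : realType} (a : R) (lambda : zzspace R -> R) (x : zzspace R) := Zigzag {
  zz_disp : measure_display ;
  zz_Omega : measurableType zz_disp ;
  zz_P : probability zz_Omega R ;
  zz_Z : nat -> {RV zz_P >-> R} ;
  zz_Y : R -> {RV zz_P >-> R} ;
  zz_J : R -> {RV zz_P >-> bool} ;
  zz_Y0 : forall w, zz_Y 0 w = x.1 ;
  zz_J0 : forall w, zz_J 0 w = x.2 ;
  zz_Z_law : forall (i : nat) (t : R), 0 <= t ->
    is_cond_prob zz_P (g_sigma_preimage (fun k : 'I_i => zz_Z k : zz_Omega -> R))
      [set w | t < zz_Z i w]
      (fun w => survival a lambda t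
        (zz_Y (jump_time zz_Z i w) w, zz_J (jump_time zz_Z i w) w)) ;
  zz_J_between : forall (i : nat) (t : R) w,
    jump_time zz_Z i w < t < jump_time zz_Z i.+1 w ->
    zz_J t w = zz_J (jump_time zz_Z i w) w ;
  zz_J_jump : forall (i : nat) w,
    zz_J (jump_time zz_Z i.+1 w) w = ~~ zz_J (jump_time zz_Z i w) w ;
  zz_Y_path : forall (i : nat) (t : R) w,
    jump_time zz_Z i w < t <= jump_time zz_Z i.+1 w ->
    zz_Y t w = zz_Y (jump_time zz_Z i w) w
      + sgn (zz_J (jump_time zz_Z i w) w) * a * (t - jump_time zz_Z i w)
}.

Definition zz_prob {R : realType} (a : R) (lambda : zzspace R -> R) (x : zzspace R)
    (X : zigzag a lambda x) (t : R) (A : set (zzspace R)) : \bar R :=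
  zz_P X [set w | A (zz_Y X t w, zz_J X t w)].

(* [X x] is the process under P_x. Measurability in the starting point is what
   gives the integral against [mu] its meaning. *)
Definition zz_invariant {R : realType} (a : R) (lambda : zzspace R -> R)
    (X : forall x, zigzag a lambda x) (mu : {measure set (zzspace R) -> \bar R}) : Prop :=
  forall (t : R) (A : set (zzspace R)), 0 <= t -> measurable A ->
    measurable_fun [set: zzspace R] (fun x : zzspace R => zz_prob (X x) t A) /\
    (\int[mu]_x zz_prob (X x) t A)%E = mu A.

(* Main.v *)
From HB Require Import structures.
Require Import Defs.
From mathcomp Require Import all_boot all_order all_algebra.
From mathcomp Require Import all_classical all_reals all_analysis.
From mathcomp Require Import measurable_realfun.
From mathcomp Require Import ring lra.
Import Order.TTheory GRing.Theory Num.Theory.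
Import numFieldNormedType.Exports.
Local Open Scope classical_set_scope.
Set Implicit Arguments.
Unset Strict Implicit.
Unset Printing Implicit Defensive.
Local Open Scope ring_scope.

(** Write [E] for the state space, [flow s] for the motion at speed [a] without
    jumps, [flip] for the reversal of the direction and [mu] for the measure
    with density [exp (- Psi)].

    Why [mu] is invariant. Kill the deterministic motion at the first jump:
    this gives the operators K_s g(x) = exp(- int_0^s lambda(flow u x) du)
    g(flow s x). Let B g(x) = lambda(x) g(flip x) be the jump operator and
    Q_n(t) the part of the semigroup on which exactly [n] jumps occur before
    [t], so that Q_0 = K and Q_(n+1)(t) = int K_s B Q_n(t - s) ds. Twist the
    scalar product of L^2(mu) by the flip: [f, g] = int f(flip x) g(x) mu(dx).
    Since Psi' is 1/a times the difference of the two switching rates, moving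
    the weight [exp (- Psi)] along the flow turns the survival weight of a
    trajectory into the survival weight of the same trajectory run backwards
    ([skew_balance]). Thus every K_s is symmetric for the twisted form, and so
    is B. As Q_n(t) is an iterated convolution of K and B, which reads the same
    in both directions, it is symmetric too ([njumps_dual]). Taking f = 1 and
    for g an indicator 1_A yields
      int Q_n(t) 1_A dmu = int_A Q_n(t) 1 (flip x) mu(dx),
    and summing over [n] leaves mu(A) on the right, provided that the
    sum over [n] of Q_n(t) 1 is 1: that is the absence of explosion.

    Why the realizations of the process are described by Q_n. The conditional
    survival functions of the holding times give the joint law of the chain of
    jump times and jump positions ([ge0_integral_conditional_density]), from
    which the probability of having made [n] jumps at time [t] and of being in
    [A] is Q_n(t) 1_A ([prob_njumps]). Hypothesis [hi] enters here: it makes the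
    survival functions vanish at infinity, so that the jump densities have
    mass 1. Explosion is excluded because up to time [t] the process stays in a
    compact set, on which the switching rate is bounded by some M; the
    expectation of exp (- 2 M T_n) on the event T_n <= t is then at least
    halved at each jump ([jump_times_unbounded]).

    The bounds on Psi: by [hii] it decreases before [- y0] and increases after
    [y0], and it is continuous in between ([potential_bounded_below]). *)

(** * Densities, translations and conditional laws *)

Section density.
Local Open Scope ereal_scope.
Context d (T : measurableType d) (R : realType).
Variable mu : {measure set T -> \bar R}.
Variable k : T -> R.
Hypotheses (mk : measurable_fun [set: T] k) (k0 : forall x, (0 <= k x)%R).

(** The proofs are arguments so that the measure structure can be inferred from
    the term. *)
Definition density_measure of measurable_fun [set: T] k & (forall x, (0 <= k x)%R) :
  set T -> \bar R := fun A => \int[mu]_(x in A) (k x)%:E.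

Local Notation nu := (density_measure mk k0).

Let mEk : measurable_fun [set: T] (EFin \o k).
Proof. exact/measurable_EFinP. Qed.

Let nu0 : nu set0 = 0. Proof. exact: integral_set0. Qed.

Let nu_ge0 A : 0 <= nu A.
Proof. by apply: integral_ge0 => x _; rewrite lee_fin. Qed.

Let nu_sigma_additive : semi_sigma_additive nu.
Proof.
move=> F mF tF mUF.
rewrite [X in _ --> X](_ : _ = \sum_(n <oo) nu (F n)).
  by apply/cvg_closeP; split; [exact: is_cvg_nneseries|rewrite closeE].
rewrite /density_measure ge0_integral_bigcup//.
  exact: measurable_funTS.
by move=> x _; rewrite lee_fin.
Qed.

HB.instance Definition _ := isMeasure.Build _ _ _ nu nu0 nu_ge0 nu_sigma_additive.

Definition density : {measure set T -> \bar R} := nu.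

Import HBNNSimple.

Let integral_density_nnsfun (h : {nnsfun T >-> R}) :
  \int[nu]_x (h x)%:E = \int[mu]_x ((h x)%:E * (k x)%:E).
Proof.
under [LHS]eq_integral do rewrite fimfunE -fsumEFin//.
rewrite [LHS]ge0_integral_fsum//; last 2 first.
  - by move=> r; exact/measurable_EFinP/measurableT_comp.
  - by move=> n x _; rewrite EFinM nnfun_muleindic_ge0.
under [RHS]eq_integral.
  move=> x xD; rewrite fimfunE -fsumEFin// muleC ge0_mule_fsumr; last first.
    by move=> r; rewrite EFinM nnfun_muleindic_ge0.
  over.
rewrite [RHS]ge0_integral_fsum//; last 2 first.
  - move=> r; apply: emeasurable_funM => //.
    by apply/measurable_EFinP; apply/measurableT_comp => //.
  - by move=> n x _; rewrite mule_ge0 ?lee_fin// -lee_fin EFinM nnfun_muleindic_ge0.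
apply: eq_fsbigr => r _.
have [r0|r0] := ltP r 0%R.
  rewrite preimage_nnfun0//.
  rewrite integral0_eq; last by move=> x _; rewrite indic0 mulr0.
  by rewrite integral0_eq// => x _; rewrite indic0 mulr0 mule0.
under [RHS]eq_integral do rewrite EFinM muleCA.
rewrite [RHS]ge0_integralZl//; last 2 first.
  apply: emeasurable_funM => //.
  by apply/measurable_EFinP; exact: measurable_indic.
  by move=> x _; rewrite mule_ge0// lee_fin.
rewrite integralZl_indic_nnsfun// integral_indic// setIT; congr (_ * _).
transitivity (\int[mu]_(x in h @^-1` [set r]) (k x)%:E) => //.
rewrite integral_mkcond; apply: eq_integral => x _.
by rewrite epatch_indic.
Qed.

Lemma ge0_integral_density (f : T -> \bar R) :
  measurable_fun [set: T] f -> (forall x, 0 <= f x) ->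
  \int[density]_x f x = \int[mu]_x (f x * (k x)%:E).
Proof.
move=> mf f0; rewrite /density; pose f_ := nnsfun_approx measurableT mf.
have f_f x : (f_ n x)%:E @[n --> \oo] --> f x by exact: cvg_nnsfun_approx.
have ndf_ x : nondecreasing_seq (fun n => (f_ n x)%:E).
  by move=> m n mn; rewrite lee_fin; exact/lefP/nd_nnsfun_approx.
transitivity (limn (fun n => \int[nu]_x (f_ n x)%:E)).
  rewrite -monotone_convergence//.
  - by apply: eq_integral => x _; apply/esym/cvg_lim.
  - by move=> n; exact/measurable_EFinP/measurable_funP.
  - by move=> n x _; rewrite lee_fin.
under eq_fun do rewrite integral_density_nnsfun.
rewrite -monotone_convergence//.
- apply: eq_integral => x _; apply/cvg_lim => //.
  exact: cvgeZr.
- move=> n; apply: emeasurable_funM => //.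
  exact/measurable_EFinP.
- by move=> n x _; rewrite mule_ge0// lee_fin.
- by move=> x _ m n mn; apply: lee_wpmul2r; [rewrite lee_fin|exact: ndf_].
Qed.

End density.

Section real_line.
Local Open Scope ereal_scope.
Context (R : realType).
Local Notation mu := (@lebesgue_measure R).
Implicit Types f : R -> \bar R.

(** The image of Lebesgue measure by a translation agrees with it on intervals.
    *)
Lemma ge0_integral_translate (c : R) f :
  measurable_fun [set: R] f -> (forall x, 0 <= f x) ->
  \int[mu]_x f (x + c)%R = \int[mu]_x f x.
Proof.
move=> mf f0.
have mT : measurable_fun [set: measurableTypeR R] (+%R^~ c : _ -> measurableTypeR R).
  exact: measurable_funD.
rewrite [LHS](_ : _ = \int[pushforward mu (+%R^~ c : _ -> measurableTypeR R)]_x f x).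
  apply: eq_measure_integral => A mA _.
  apply/esym/lebesgue_measure_unique => //= _ [[u v]] _ <-.
  rewrite /pushforward (_ : _ @^-1` _ = `](u - c)%R, (v - c)%R]%classic); last first.
    by apply/seteqP; split => x /=; rewrite !in_itv/= ltrBlDr lerBrDr.
  rewrite !lebesgue_measure_itv/= !lte_fin ltrD2r; case: ifP => // _.
  by rewrite -!EFinB; congr EFin; ring.
by rewrite ge0_integral_pushforward.
Qed.

Lemma ge0_integral_reflect (c : R) f :
  measurable_fun [set: R] f -> (forall x, 0 <= f x) ->
  \int[mu]_x f (c - x)%R = \int[mu]_x f x.
Proof.
move=> mf f0; rewrite -(ge0_integral_translate c mf f0).
have mfc : measurable_fun [set: R] (fun x : R => f (x + c)%R).
  by apply: (measurableT_comp mf); exact: measurable_funD.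
rewrite [RHS](_ : _ = \int[pushforward mu (-%R : _ -> measurableTypeR R)]_x f (x + c)%R).
  by rewrite ge0_integral_pushforward//; apply: eq_integral => x _/=; rewrite addrC.
by apply: eq_measure_integral => A mA _; exact/esym/lebesgue_measureN.
Qed.

End real_line.

Section rays.
Local Open Scope ereal_scope.
Context d (T : measurableType d) (R : realType).
Variables m1 m2 : {measure set (T * R)%type -> \bar R}.

(** Rays generate the Borel sets and are stable under intersection, so
    uniqueness holds first for the second coordinate with the first one
    confined to [A], then for the product. *)
Lemma measure_unique_rays :
  m1 [set: T * R] < +oo ->
  (forall A (t : R), measurable A -> m1 (A `*` `]t, +oo[%classic) = m2 (A `*` `]t, +oo[%classic)) ->
  forall X, measurable X -> m1 X = m2 X.
Proof.
move=> m1oo m12.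
have rect A B : measurable A -> measurable B -> m1 (A `*` B) = m2 (A `*` B).
  move=> mA mB.
  have mAT : measurable (A `*` [set: R]) by exact: measurableX.
  have nE (m : {measure set (T * R)%type -> \bar R}) C :
      pushforward (mrestr m mAT) (snd : T * R -> R) C = m (A `*` C).
    rewrite /pushforward/= /mrestr; congr (m _).
    by apply/seteqP; split => -[x y]/= []; [move=> ? []|move=> ? ?].
  rewrite -!nE.
  apply: (measure_unique (@RGenOInfty.G R) (fun n => `](- n%:R)%R, +oo[%classic)) => //.
  - exact: RGenOInfty.measurableE.
  - move=> _ _ [x ->] [y ->]; exists (Num.max x y).
    by apply/seteqP; split => z/=; rewrite !in_itv/= !andbT gt_max; [move=> [-> ->]|move=> /andP].
  - by move=> i; exists (- i%:R)%R.
  - apply/seteqP; split => // x _; have xn := archi_boundP (normr_ge0 x).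
    exists (Num.bound `|x|)%R => //=; rewrite in_itv/= andbT ltrNl.
    by apply: le_lt_trans xn; rewrite -normrN ler_norm.
  - move=> _ [t ->]; have := m12 A t mA; rewrite -!nE; exact.
  - move=> k; suff : m1 (A `*` `](- k%:R)%R, +oo[%classic) < +oo by rewrite -nE; exact.
    apply: le_lt_trans m1oo; apply: le_measure => //; rewrite inE//.
    exact: measurableX.
apply: (measure_unique [set A `*` B | A in measurable & B in measurable] (fun=> setT)) => //.
- exact: measurable_prod_measurableType.
- move=> _ _ [A mA [B mB <-]] [C mC [D mD <-]].
  exists (A `&` C); first exact: measurableI.
  by exists (B `&` D); [exact: measurableI|rewrite setXI].
- move=> _; exists setT => //; exists setT => //; exact: setXTT.
- by apply/seteqP; split => // x _; exists 0%N.
- by move=> _ [A mA [B mB <-]]; exact: rect.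
Qed.

End rays.

Section conditional_density.
Local Open Scope ereal_scope.
Context d (Omega : measurableType d) (R : realType) (P : probability Omega R).
Context d' (T : measurableType d').
Variables (S : set (set Omega)) (V : Omega -> T) (Z : Omega -> R) (k : T * R -> R).
Hypotheses (mS : S `<=` measurable).
Hypothesis SV : forall B, measurable B -> S (V @^-1` B).
Hypothesis mZ : measurable_fun [set: Omega] Z.
Hypotheses (mk : measurable_fun [set: T * R] k) (k0 : forall p, (0 <= k p)%R).
Hypothesis tailZ : forall C (t : R), S C ->
  P ([set w | (t < Z w)%R] `&` C) =
  \int[P]_(w in C) \int[lebesgue_measure]_(s in `]t, +oo[) (k (V w, s))%:E.

Let mV : measurable_fun [set: Omega] V.
Proof. by move=> _ B mB; rewrite setTI; exact/mS/SV. Qed.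

Let V2 (p : Omega * R) := (V p.1, p.2).

Let mV2 : measurable_fun [set: Omega * R] V2.
Proof. by apply: measurable_fun_pair => //; exact: measurableT_comp. Qed.

Let mVZ : measurable_fun [set: Omega] (fun w => (V w, Z w)).
Proof. exact: measurable_fun_pair. Qed.

Let mkV : measurable_fun [set: Omega * R] (k \o V2).
Proof. exact: measurableT_comp. Qed.

Let kV0 p : (0 <= (k \o V2) p)%R. Proof. exact: k0. Qed.

(** A conditional survival function with a density determines the joint law of
    [(V, Z)]: the law and the measure [k (V w, s) dP ds] carried by [V] agree
    on products of a measurable set with a ray. *)
Lemma ge0_integral_conditional_density (h : T * R -> \bar R) :
  measurable_fun [set: T * R] h -> (forall p, 0 <= h p) ->
  \int[P]_w h (V w, Z w) =
  \int[P]_w \int[lebesgue_measure]_s (h (V w, s) * (k (V w, s))%:E).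
Proof.
move=> mh h0.
pose D := density (P \x @lebesgue_measure R) mkV kV0.
transitivity (\int[pushforward P (fun w => (V w, Z w))]_p h p).
  by rewrite ge0_integral_pushforward.
(* Both measures on the product space are images, so it suffices to compare
   them on products with rays. *)
transitivity (\int[pushforward D V2]_p h p).
  apply: eq_measure_integral => X mX _.
  apply: measure_unique_rays mX.
    by rewrite -[X in X < _]/(P setT) probability_setT ltry.
  move=> A t mA.
  transitivity (P ([set w | (t < Z w)%R] `&` V @^-1` A)).
    congr (P _); apply/seteqP; split => w /=; rewrite in_itv/= andbT => -[] //.
  rewrite tailZ; last exact: SV.
  transitivity (D ((V @^-1` A) `*` `]t, +oo[)); last by [].
  rewrite /D /density/= /density_measure [RHS]integral_mkcond fubini_tonelli1/=.
  - rewrite [LHS]integral_mkcond; congr (integral _ _ _); apply/funext => w.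
    rewrite patchE /fubini_F; case: ifPn => [/set_mem|/negP] wA.
      rewrite [LHS]integral_mkcond; congr (integral _ _ _); apply/funext => s.
      rewrite !patchE; congr (if _ then _ else _).
      by apply/idP/idP => /set_mem sA; apply/mem_set => //=; case: sA.
    rewrite integral0_eq// => s _; rewrite patchE ifN//.
    by apply/negP => /set_mem[/= Aw _]; apply: wA; exact/mem_set.
  - apply/(measurable_restrictT _ _).1.
      by apply: measurableX => //; exact/mS/SV.
    by apply: measurable_funTS; exact/measurable_EFinP.
  - by move=> p; rewrite patchE; case: ifP => // _; rewrite lee_fin.
rewrite ge0_integral_pushforward//.
have mhV : measurable_fun [set: Omega * R] (h \o V2) by exact: measurableT_comp.
rewrite ge0_integral_density//=.
rewrite fubini_tonelli1//=.
  by apply: emeasurable_funM => //; exact/measurable_EFinP.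
by move=> p; rewrite mule_ge0// ?h0// lee_fin.
Qed.

End conditional_density.

(** * Primitives of continuous functions *)

Section primitive.
Context (R : realType).
Local Notation mu := (@lebesgue_measure R).
Implicit Types f F : R -> R.

Lemma is_derive1_continuous F (l x : R) : is_derive x 1 F l -> {for x, continuous F}.
Proof.
by move=> dF; apply: differentiable_continuous; apply/derivable1_diffP; exact: ex_derive.
Qed.

Lemma is_derive1_shift F (l c x : R) :
  is_derive x 1 F l -> is_derive x 1 (fun y => F y - c) l.
Proof. by move=> dF; apply: is_derive_eq; rewrite subr0. Qed.

Lemma integral_is_derive f F (u v : R) : u <= v ->
  {within `[u, v], continuous f} ->
  (forall x : R, u <= x <= v -> is_derive x 1 F (f x)) ->
  (\int[mu]_(x in `[u, v]) (f x)%:E = (F v - F u)%:E)%E.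
Proof.
rewrite le_eqVlt => /predU1P[<- _ _|uv cf dF].
  by rewrite set_itv1 integral_set1 subrr.
have cF x : u <= x <= v -> {for x, continuous F}.
  by move=> /dF; exact: is_derive1_continuous.
rewrite EFinB; apply: continuous_FTC2 => //.
  split.
  - by move=> x; rewrite in_itv/= => /andP[/ltW ux /ltW xv]; apply: ex_derive; apply: dF; rewrite ux.
  - by apply: cvg_at_right_filter; apply: cF; rewrite lexx ltW.
  - by apply: cvg_at_left_filter; apply: cF; rewrite lexx ltW.
move=> x; rewrite in_itv/= => /andP[/ltW ux /ltW xv].
have dFx : is_derive x 1 F (f x) by apply: dF; rewrite ux.
by rewrite derive1E; exact: derive_val.
Qed.

(** The two branches of [integral_from0] are reunited: the primitive makes one
    formula of them, which is what turns the survival weight and [Psi] into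
    differences of primitives. *)
Lemma integral_from0_is_derive f F : continuous f ->
  (forall x : R, is_derive x 1 F (f x)) ->
  forall y, integral_from0 f y = (F y - F 0)%:E.
Proof.
move=> cf dF y; rewrite /integral_from0; case: ifPn => [y0|].
  by rewrite (integral_is_derive y0 (continuous_subspaceT cf) (fun x _ => dF x)).
rewrite -ltNge => /ltW y0.
rewrite (integral_is_derive y0 (continuous_subspaceT cf) (fun x _ => dF x)).
by rewrite -EFinN opprB.
Qed.

(** The fundamental theorem of calculus differentiates integrals with a fixed
    left end, and only to the right of it. Near [x], the signed integral from 0
    differs by a constant from the integral with left end [b], where [b] is
    smaller than both [x] and 0. *)
Lemma continuous_has_primitive f : continuous f ->
  exists F, F 0 = 0 /\ forall x : R, is_derive x 1 F (f x).
Proof.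
move=> cf; pose F y := fine (integral_from0 f y).
exists F; split; first by rewrite /F /integral_from0 lexx set_itv1 integral_set1.
move=> x; pose b := Num.min 0 x - 1.
have b0 : b < 0 by rewrite /b ltrBlDr add0r gt_min ltr01.
have bx : b < x by rewrite /b ltrBlDr gt_min ltrDl ltr01 orbT.
pose G y := (\int[mu]_(t in `[b, y]) f t)%R.
have ci u v : {within `[u, v], continuous f} by exact: continuous_subspaceT.
have dG y : b < y -> is_derive y 1 G (f y).
  move=> byy; have [] := @continuous_FTC1_closed _ f b y (y + 1) _ _ byy.
  - by rewrite ltrDl.
  - by apply: continuous_compact_integrable => //; exact: segment_compact.
  - exact: cf.
  - by move=> dG <-; rewrite derive1E; exact/derivableP.
have FG y : b < y -> F y = G y - G 0.
  move=> byy; rewrite /F /integral_from0; case: ifPn => [y0|].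
    have dGy z : 0 <= z <= y -> is_derive z 1 G (f z).
      by move=> /andP[z0 _]; apply: dG; exact: lt_le_trans z0.
    by rewrite (integral_is_derive y0 (ci _ _) dGy).
  rewrite -ltNge => /ltW y0.
  have dGy z : y <= z <= 0 -> is_derive z 1 G (f z).
    by move=> /andP[yz _]; apply: dG; exact: lt_le_trans yz.
  by rewrite (integral_is_derive y0 (ci _ _) dGy)/= opprB.
apply: (near_eq_is_derive (f := fun y => G y - G 0)).
- near=> y; apply/esym/FG; near: y; exact: lt_nbhsr.
- exact/is_derive1_shift/dG.
Unshelve. all: by end_near. Qed.

Lemma integral_expR_decay (c : R) : 0 < c ->
  (\int[lebesgue_measure]_(s in `[0%R, +oo[) (expR (- (c * s)))%:E = (c^-1)%:E)%E.
Proof.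
move=> c0.
have dc (s : R) : is_derive s 1 (fun s : R => - (c * s)) (- c).
  rewrite (_ : (fun s => _) = (- c) *: @id R); last by apply/funext => u; rewrite mulrC -mulrN mulrC.
  by apply: is_derive_eq; rewrite /GRing.scale/= mulr1.
have dE (s : R) : is_derive s 1 (expR \o (fun s : R => - (c * s))) (expR (- (c * s)) * - c).
  exact: is_derive1_comp.
have dF (s : R) : is_derive s 1 (fun s : R => - c^-1 * expR (- (c * s))) (expR (- (c * s))).
  rewrite (_ : (fun s => _) = (- c^-1) *: (expR \o (fun s : R => - (c * s))))//.
  apply: is_derive_eq; rewrite /GRing.scale/=; field.
  by rewrite gt_eqF.
rewrite (@ge0_continuous_FTC2y _ _ (fun s => - c^-1 * expR (- (c * s))) _ 0).
- by rewrite sub0e -EFinN mulr0 oppr0 expR0 mulr1 opprK.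
- by move=> s _; exact: expR_ge0.
- apply: continuous_subspaceT => s; exact: is_derive1_continuous (dE s).
- rewrite -[X in _ --> X](mulr0 (- c^-1)); apply: cvgM; first exact: cvg_cst.
  apply: (cvg_comp (fun s => c * s) _ _ (@cvgr_expR R)).
  apply/cvgryPge => M; apply: filterS (nbhs_pinfty_ge (num_real (c^-1 * M))) => s.
  by rewrite ler_pdivrMl.
- by move=> s _; exact: ex_derive.
- apply: cvg_at_right_filter; exact: is_derive1_continuous (dF 0).
- by move=> s _; rewrite derive1E; exact: derive_val.
Qed.

End primitive.

(** * The linear flow, its survival weight and the potential *)

Lemma sgn_sqr (R : realType) (j : bool) : sgn j * sgn j = 1 :> R.
Proof. by case: j; rewrite /sgn ?mulrNN mulr1. Qed.

Lemma sgnN (R : realType) (j : bool) : sgn (~~ j) = - sgn j :> R.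
Proof. by case: j; rewrite /sgn ?opprK. Qed.

(** The direction takes two values only, so measurability may be checked for
    each direction separately. *)
Lemma measurable_fun_signed d d' (T : measurableType d) (U : measurableType d')
    (f : T * bool -> U) :
  (forall j, measurable_fun [set: T] (fun y => f (y, j))) ->
  measurable_fun [set: T * bool] f.
Proof.
move=> mf.
rewrite (_ : f = fun x => if x.2 then f (x.1, true) else f (x.1, false)); last first.
  by apply/funext => -[y []].
apply: measurable_fun_ifT => //.
  exact: (measurableT_comp (mf true)).
exact: (measurableT_comp (mf false)).
Qed.

Lemma measurable_sgn (R : realType) : measurable_fun [set: bool] (@sgn R).
Proof. by []. Qed.

Section zigzag_flow.
Context (R : realType) (a : R) (lambda : zzspace R -> R).
Hypothesis a_gt0 : 0 < a.
Hypothesis lambda_ge0 : forall x, 0 <= lambda x.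
Hypothesis lambda_cont : continuous lambda.
Variable L : bool -> R -> R.
Hypothesis dL : forall j (y : R), is_derive y 1 (L j) (lambda (y, j)).
Implicit Types (s t : R) (x : zzspace R).

Definition zz_flow s x : zzspace R := (x.1 + a * sgn x.2 * s, x.2).

Definition zz_flip x : zzspace R := (x.1, ~~ x.2).

(** Extended by 0 to negative times, so that recursions over the number of
    jumps become convolutions over the whole line. *)
Definition zz_alive s x : R := if 0 <= s then survival a lambda s x else 0.

(** The density of the law of the first jump time. *)
Definition zz_jump_density s x : R := zz_alive s x * lambda (zz_flow s x).

(** The integral of the rate along the flow, through the primitives [L] of the
    two rates; this form makes sense for negative [s] and is differentiable in
    [s]. *)
Definition cum_rate s x : R :=
  sgn x.2 / a * (L x.2 (x.1 + a * sgn x.2 * s) - L x.2 x.1).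

Lemma flipK : involutive zz_flip.
Proof. by move=> [y j]; rewrite /zz_flip/= negbK. Qed.

(** Running a trajectory, turning round, and running for the same time leads
    back to the starting point, in the opposite direction. *)
Lemma flow_flip_flow s x : zz_flow s (zz_flip (zz_flow s x)) = zz_flip x.
Proof.
rewrite /zz_flow /zz_flip/= sgnN; congr pair.
by rewrite mulrN mulNr addrK.
Qed.

Lemma lambda_cont1 j : continuous (fun y => lambda (y, j)).
Proof.
have cpair : continuous (fun y : R => (y, j) : zzspace R).
  by move=> y; apply: (@cvg_pair _ _ _ (nbhs y) (nbhs y) (nbhs j)); [exact: cvg_id|exact: cvg_cst].
move=> y; have lc : {for (y, j), continuous lambda} by exact: lambda_cont.
exact: (continuous_comp (cpair y) lc).
Qed.

Lemma cont_lambda_flow x : continuous (fun s => lambda (zz_flow s x)).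
Proof.
move=> s; apply: (@continuous_comp _ _ _ (fun s => x.1 + a * sgn x.2 * s) (fun y => lambda (y, x.2))); last exact: lambda_cont1.
by apply: cvgD; [exact: cvg_cst|apply: cvgM; [exact: cvg_cst|exact: cvg_id]].
Qed.

Lemma is_derive_cum_rate s x :
  is_derive s 1 (cum_rate ^~ x) (lambda (zz_flow s x)).
Proof.
have dflow : is_derive s 1 (fun s => x.1 + a * sgn x.2 * s) (a * sgn x.2).
  have -> : (fun s => x.1 + a * sgn x.2 * s) = cst x.1 + (a * sgn x.2) *: @id R by [].
  have dZ : is_derive s 1 ((a * sgn x.2) *: @id R) (a * sgn x.2).
    by apply: is_derive_eq; rewrite /GRing.scale/= mulr1.
  by rewrite -[X in is_derive _ _ _ X]add0r; exact: is_deriveD.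
have dLf : is_derive s 1 (L x.2 \o (fun s => x.1 + a * sgn x.2 * s))
    (lambda (zz_flow s x) * (a * sgn x.2)).
  exact: is_derive1_comp.
have -> : cum_rate ^~ x = (sgn x.2 / a) *: ((L x.2 \o (fun s => x.1 + a * sgn x.2 * s)) - cst (L x.2 x.1)).
  by [].
apply: is_derive_eq; rewrite /GRing.scale/= subr0.
have -> : sgn x.2 / a * (lambda (zz_flow s x) * (a * sgn x.2)) =
    (a / a) * (sgn x.2 * sgn x.2) * lambda (zz_flow s x) by ring.
by rewrite sgn_sqr divff ?gt_eqF// !mul1r.
Qed.

Lemma survivalE s x : 0 <= s -> survival a lambda s x = expR (- cum_rate s x).
Proof.
move=> s0; rewrite /survival; congr (expR (- _)).
rewrite /Rintegral.
have := integral_is_derive s0 (continuous_subspaceT (@cont_lambda_flow x)) (fun s _ => is_derive_cum_rate s x).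
rewrite /zz_flow => -> /=.
by rewrite {2}/cum_rate mulr0 addr0 subrr mulr0 subr0.
Qed.

Lemma aliveE s x : zz_alive s x = if 0 <= s then expR (- cum_rate s x) else 0.
Proof. by rewrite /zz_alive; case: ifPn => // /survivalE. Qed.

Lemma alive_ge0 s x : 0 <= zz_alive s x.
Proof. by rewrite aliveE; case: ifP => // _; exact: expR_ge0. Qed.

Lemma survival0 x : survival a lambda 0 x = 1.
Proof. by rewrite /survival set_itv1 Rintegral_set1 oppr0 expR0. Qed.

Lemma alive_le1 s z : zz_alive s z <= 1.
Proof.
rewrite /zz_alive; case: ifP => // _; rewrite /survival -expR0 ler_expR oppr_le0.
by apply: Rintegral_ge0.
Qed.

Lemma lambda_bounded (c r : R) : exists2 M, 0 < M &
  forall z : zzspace R, `|z.1 - c| <= r -> lambda z <= M.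
Proof.
have [r0|r0] := ltP r 0.
  by exists 1 => // z zr; have := lt_le_trans r0 (le_trans (normr_ge0 _) zr); rewrite ltxx.
have H j : exists M, forall y, y \in `[c - r, c + r] -> lambda (y, j) <= M.
  have [||u _ uP] := @EVT_max _ (fun y => lambda (y, j)) (c - r) (c + r).
  - lra.
  - exact/continuous_subspaceT/lambda_cont1.
  - by exists (lambda (u, j)).
have [M1 M1P] := H true; have [M2 M2P] := H false.
exists (`|M1| + `|M2| + 1); first by rewrite ltr_wpDl.
move=> [y j]/= yr.
have yi : y \in `[c - r, c + r].
  by rewrite in_itv/=; move: yr; rewrite ler_norml => /andP[? ?]; apply/andP; split; lra.
case: j; [have := M1P _ yi|have := M2P _ yi]; have := ler_norm M1; have := ler_norm M2;
  have := normr_ge0 M1; have := normr_ge0 M2; lra.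
Qed.

Lemma jump_density_ge0 s x : 0 <= zz_jump_density s x.
Proof. by rewrite mulr_ge0// alive_ge0. Qed.

(** The density of the invariant measure. *)
Definition boltzmann (y : R) : R := expR (- ((L true y - L false y) / a)).

(** Exchanging the rates of the two directions along a segment costs exactly
    the variation of the potential. Both sides are exponentials of linear
    combinations of values of [L] at the two ends of the segment, and these
    combinations coincide. *)
Lemma skew_balance s x :
  zz_alive s x * boltzmann x.1 = zz_alive s (zz_flip (zz_flow s x)) * boltzmann (zz_flow s x).1.
Proof.
rewrite !aliveE; case: ifP => _; last by rewrite !mul0r.
rewrite -!expRD; congr expR; rewrite /cum_rate /zz_flip /zz_flow/=.
case: x => y j /=; rewrite sgnN (_ : y + a * sgn j * s + a * - sgn j * s = y).
  by case: j; rewrite /sgn/=; field; rewrite gt_eqF.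
by ring.
Qed.

Lemma measurable_L : measurable_fun [set: R * bool] (fun x => L x.2 x.1).
Proof.
apply: measurable_fun_signed => j /=; apply: continuous_measurable_fun => y.
exact: is_derive1_continuous.
Qed.

Lemma measurable_lambda : measurable_fun [set: R * bool] lambda.
Proof.
by apply: measurable_fun_signed => j; apply: continuous_measurable_fun; exact: lambda_cont1.
Qed.

Lemma measurable_flow : measurable_fun [set: R * (R * bool)] (fun p => zz_flow p.1 p.2).
Proof.
apply: measurable_fun_pair => /=; last exact: (measurableT_comp measurable_snd).
apply: measurable_funD; first exact: (measurableT_comp measurable_fst).
apply: measurable_funM => //.
apply: measurable_funM => //.
apply: (measurableT_comp (@measurable_sgn R)).
exact: (measurableT_comp measurable_snd).
Qed.

Lemma measurable_flip : measurable_fun [set: R * bool] zz_flip.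
Proof. by apply: measurable_fun_signed => j; apply: measurable_fun_pair => //=; exact: measurable_cst. Qed.

Lemma measurable_alive : measurable_fun [set: R * (R * bool)] (fun p => zz_alive p.1 p.2).
Proof.
under eq_fun do rewrite aliveE.
apply: measurable_fun_ifT => //.
  by apply: measurable_fun_ler => //.
apply: (measurableT_comp (@measurable_expR R)).
apply: measurable_funN => /=; apply: measurable_funM.
  apply: measurable_funM => //.
  apply: (measurableT_comp (@measurable_sgn R)).
  exact: (measurableT_comp measurable_snd).
apply: measurable_funB.
  exact: (measurableT_comp measurable_L measurable_flow).
exact: (measurableT_comp measurable_L measurable_snd).
Qed.

Lemma measurable_jump_density :
  measurable_fun [set: R * (R * bool)] (fun p => zz_jump_density p.1 p.2).
Proof.
apply: measurable_funM; first exact: measurable_alive.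
exact: (measurableT_comp measurable_lambda measurable_flow).
Qed.

Lemma measurable_boltzmann : measurable_fun [set: R] boltzmann.
Proof.
apply: (measurableT_comp (@measurable_expR R)); apply: measurable_funN.
apply: measurable_funM => //; apply: measurable_funB;
  apply: continuous_measurable_fun => y; exact: is_derive1_continuous.
Qed.

Section tail.
Variables (y0 lambda_min : R).
Hypothesis lambda_min_gt0 : 0 < lambda_min.
Hypothesis hi : forall (y : R) (j : bool), y0 <= sgn j * y -> lambda_min <= lambda (y, j).

(** After time [b] the particle is beyond [y0] in its direction of motion,
    where the rate is at least [lambda_min]. *)
Lemma cum_rate_growth x : exists b, forall s, b < s ->
  cum_rate b x + lambda_min * (s - b) <= cum_rate s x.
Proof.
exists ((y0 - sgn x.2 * x.1) / a) => s bs.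
set b := _ / a in bs *.
have [|c] := MVT bs (fun u _ => is_derive_cum_rate u x).
  apply: continuous_subspaceT => u.
  by apply: is_derive1_continuous; exact: is_derive_cum_rate.
rewrite in_itv/= => /andP[bc _] E.
rewrite -lerBrDl E ler_wpM2r ?subr_ge0 ?(ltW bs)//; apply: hi => /=.
rewrite mulrDr -lerBlDl.
have -> : sgn x.2 * (a * sgn x.2 * c) = a * c.
  by rewrite -[RHS]mul1r -(sgn_sqr R x.2); ring.
by move: bc; rewrite /b ltr_pdivrMr// (mulrC c) => /ltW; rewrite lerBlDr addrC -lerBlDr.
Qed.

Lemma survival_cvg0 x : expR (- cum_rate s x) @[s --> +oo] --> 0.
Proof.
have [b bP] := cum_rate_growth x.
have cb : expR (- (cum_rate b x + lambda_min * (s - b))) @[s --> +oo] --> 0.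
  apply: (cvg_comp (fun s => cum_rate b x + lambda_min * (s - b)) _ _ (@cvgr_expR R)).
  apply/cvgryPge => M; near=> s.
  rewrite -lerBlDl -ler_pdivrMl// lerBrDr.
  by near: s; apply: nbhs_pinfty_ge; exact: num_real.
apply: squeeze_cvgr cb; last exact: cvg_cst.
by near=> s; rewrite expR_ge0/= ler_expR lerN2; apply: bP; near: s; apply: nbhs_pinfty_gt; exact: num_real.
Unshelve. all: end_near. Qed.

(** The survival function is a primitive of minus the jump density and tends to
    0 at infinity; as the density vanishes at negative times, a negative [t]
    may be replaced by 0. *)
Lemma integral_jump_density (t : R) x :
  (\int[lebesgue_measure]_(s in `]t, +oo[) (zz_jump_density s x)%:E = (zz_alive (Num.max 0 t) x)%:E)%E.
Proof.
have main (u : R) : 0 <= u ->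
    (\int[lebesgue_measure]_(s in `[u, +oo[) (zz_jump_density s x)%:E = (zz_alive u x)%:E)%E.
  move=> u0.
  pose g s := expR (- cum_rate s x) * lambda (zz_flow s x).
  have dE s : is_derive s 1 (fun s => expR (- cum_rate s x)) (- g s).
    have dc := is_derive_cum_rate s x.
    have dN : is_derive s 1 (fun s => - cum_rate s x) (- lambda (zz_flow s x)).
      exact: is_deriveN.
    have dEc : is_derive s 1 (expR \o (fun s => - cum_rate s x))
        (expR (- cum_rate s x) * - lambda (zz_flow s x)) by exact: is_derive1_comp.
    by rewrite /g -mulrN.
  have dNE s : is_derive s 1 (fun s => - expR (- cum_rate s x)) (g s).
    by rewrite -(opprK (g s)); exact: is_deriveN.
  have cg : continuous g.
    by move=> s; apply: cvgM; [exact: is_derive1_continuous (dE s)|exact: cont_lambda_flow].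
  transitivity (\int[lebesgue_measure]_(s in `[u, +oo[) (g s)%:E)%E.
    apply: eq_integral => s; rewrite inE/= in_itv/= andbT => us.
    by rewrite /zz_jump_density aliveE (le_trans u0 us).
  rewrite (@ge0_continuous_FTC2y _ _ (fun s => - expR (- cum_rate s x)) _ 0).
  - by rewrite sub0e -EFinN opprK aliveE u0.
  - by move=> s _; rewrite mulr_ge0// expR_ge0.
  - exact: continuous_subspaceT.
  - by rewrite -[X in _ --> X]oppr0; apply: cvgN; exact: survival_cvg0.
  - by move=> s _; exact: ex_derive.
  - apply: cvg_at_right_filter; exact: is_derive1_continuous (dNE u).
  - by move=> s _; rewrite derive1E; exact: derive_val.
have mj : measurable_fun [set: R] (fun s => (zz_jump_density s x)%:E).
  apply/measurable_EFinP.
  apply: (measurableT_comp measurable_jump_density (g := fun s => (s, x))).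
  exact: measurable_fun_pair.
have [t0|t0] := leP 0 t.
  by rewrite -main// integral_itv_obnd_cbnd//; exact: measurable_funTS.
rewrite -main// integral_mkcond [RHS]integral_mkcond; apply: eq_integral => s _.
rewrite !patchE; have [s0|s0] := ltP s 0.
  rewrite [RHS]ifN; last by apply/negP => /set_mem/=; rewrite in_itv/= andbT leNgt s0.
  case: ifP => // _; rewrite /zz_jump_density aliveE leNgt s0/= mul0r.
  by [].
by rewrite !mem_set//= in_itv/= andbT// (lt_le_trans t0).
Qed.

End tail.

End zigzag_flow.

Section potential.
Context (R : realType) (a : R) (lambda : zzspace R -> R).
Hypothesis a_gt0 : 0 < a.
Hypothesis lambda_cont : continuous lambda.
Variable L : bool -> R -> R.
Hypothesis L0 : forall j, L j 0 = 0.
Hypothesis dL : forall j (y : R), is_derive y 1 (L j) (lambda (y, j)).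

Definition potential (y : R) : R := (L true y - L false y) / a.

Lemma is_derive_potential (y : R) :
  is_derive y 1 potential ((lambda (y, true) - lambda (y, false)) / a).
Proof.
rewrite (_ : potential = a^-1 *: (L true - L false)); last first.
  by apply/funext => z; rewrite /potential mulrC.
by apply: is_derive_eq; rewrite /GRing.scale/= mulrC.
Qed.

Lemma PsiE y : Psi a lambda y = (potential y)%:E.
Proof.
rewrite /Psi (@integral_from0_is_derive _ _ (L true - L false)).
- by rewrite /potential -EFinM [in RHS]mulrC !fctE !L0 !subr0.
- by move=> z; apply: cvgB; exact: lambda_cont1.
Qed.

(** The minimum over the compact interval between [- y0] and [y0] is a global
    one, since the derivative is nonnegative to the right of it and nonpositive
    to the left. *)
Lemma potential_bounded_below (y0 : R) : 0 <= y0 ->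
  (forall (y : R) (j : bool), y0 <= sgn j * y -> lambda (y, ~~ j) <= lambda (y, j)) ->
  exists m, forall y, m <= potential y.
Proof.
move=> y00 hii.
have cp : continuous potential.
  by move=> y; apply: is_derive1_continuous; exact: is_derive_potential.
have [||c _ cP] := @EVT_min _ potential (- y0) y0.
- lra.
- exact: continuous_subspaceT.
exists (potential c) => y.
have [yle|ylt] := leP y (- y0).
  apply: le_trans (cP (- y0) _) _; first by rewrite in_itv/=; apply/andP; split; lra.
  move: yle; rewrite le_eqVlt => /predU1P[->//|yl].
  have [|z] := MVT yl (fun u _ => is_derive_potential u).
    exact: continuous_subspaceT.
  rewrite in_itv/= => /andP[_ zy] E; rewrite -subr_le0 E.
  rewrite mulr_le0_ge0 ?subr_ge0 ?(ltW yl)// mulr_le0_ge0 ?invr_ge0 ?(ltW a_gt0)//.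
  by rewrite subr_le0; apply: (hii z false); rewrite /sgn; lra.
have [yle'|yl] := leP y y0.
  by apply: cP; rewrite in_itv/= yle' ltW.
apply: le_trans (cP y0 _) _; first by rewrite in_itv/=; apply/andP; split; lra.
have [|z] := MVT yl (fun u _ => is_derive_potential u).
  exact: continuous_subspaceT.
rewrite in_itv/= => /andP[zy _] E; rewrite -subr_ge0 E.
rewrite mulr_ge0 ?subr_ge0 ?(ltW yl)// mulr_ge0 ?invr_ge0 ?(ltW a_gt0)// subr_ge0.
by apply: (hii z true); rewrite /sgn; lra.
Qed.

End potential.

(** * Time-reversal duality for killed flows with jumps *)

Section nonneg_measurable.
Local Open Scope ereal_scope.
Context (R : realType).

(** The functions to which the Tonelli theorem applies. *)
Definition nnmeas d (T : measurableType d) (f : T -> \bar R) :=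
  measurable_fun [set: T] f /\ forall x, 0 <= f x.

Lemma nnmeas_comp d (T : measurableType d) d' (U : measurableType d')
    (f : U -> \bar R) (g : T -> U) :
  nnmeas f -> measurable_fun [set: T] g -> nnmeas (fun x => f (g x)).
Proof. by move=> [mf f0] mg; split => //; exact: (measurableT_comp mf mg). Qed.

Lemma nnmeasM d (T : measurableType d) (f g : T -> \bar R) :
  nnmeas f -> nnmeas g -> nnmeas (fun x => f x * g x).
Proof.
move=> [mf f0] [mg g0]; split; first exact: emeasurable_funM.
by move=> x; rewrite mule_ge0.
Qed.

Lemma nnmeas_EFin d (T : measurableType d) (f : T -> R) :
  measurable_fun [set: T] f -> (forall x, (0 <= f x)%R) -> nnmeas (fun x => (f x)%:E).
Proof. by move=> mf f0; split; [exact/measurable_EFinP|move=> x; rewrite lee_fin]. Qed.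

Lemma nnmeas_integral d (T : measurableType d) d' (U : measurableType d')
    (M : {sigma_finite_measure set U -> \bar R}) (f : T -> U -> \bar R) :
  nnmeas (fun p : T * U => f p.1 p.2) -> nnmeas (fun x => \int[M]_y f x y).
Proof.
move=> [mf f0]; split.
  exact: (measurable_fun_fubini_tonelli_F (fun p : T * U => f p.1 p.2)).
by move=> x; apply: integral_ge0 => y _; exact: (f0 (x, y)).
Qed.

Lemma nnmeas_swap d (T : measurableType d) d' (U : measurableType d')
    (M : {sigma_finite_measure set T -> \bar R})
    (N : {sigma_finite_measure set U -> \bar R}) (f : T -> U -> \bar R) :
  nnmeas (fun p : T * U => f p.1 p.2) ->
  \int[M]_x \int[N]_y f x y = \int[N]_y \int[M]_x f x y.
Proof.
by move=> [mf f0]; exact: (fubini_tonelli (fun p : T * U => f p.1 p.2) mf f0).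
Qed.

Lemma measurable_pair_comp d (T : measurableType d) d1 (U1 : measurableType d1)
   d2 (U2 : measurableType d2) d3 (U3 : measurableType d3)
   (h : U1 -> U2 -> U3) (f : T -> U1) (g : T -> U2) :
  measurable_fun [set: U1 * U2] (fun p => h p.1 p.2) ->
  measurable_fun [set: T] f -> measurable_fun [set: T] g ->
  measurable_fun [set: T] (fun x => h (f x) (g x)).
Proof.
by move=> mh mf mg; exact: (measurableT_comp mh (measurable_fun_pair mf mg)).
Qed.

End nonneg_measurable.

Section skew_duality.
Local Open Scope ereal_scope.
Context d (E : measurableType d) (R : realType).
Variable M : {sigma_finite_measure set E -> \bar R}.
Variables (flip : E -> E) (flow : R -> E -> E).
Variables (alive : R -> E -> R) (rate weight : E -> R).
Hypothesis flipK : involutive flip.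
Hypothesis flow_flip_flow : forall s x, flow s (flip (flow s x)) = flip x.
Hypothesis mflip : measurable_fun [set: E] flip.
Hypothesis mflow : measurable_fun [set: R * E] (fun p => flow p.1 p.2).
Hypothesis malive : measurable_fun [set: R * E] (fun p => alive p.1 p.2).
Hypothesis mrate : measurable_fun [set: E] rate.
Hypothesis mweight : measurable_fun [set: E] weight.
Hypothesis alive_ge0 : forall s x, (0 <= alive s x)%R.
Hypothesis rate_ge0 : forall x, (0 <= rate x)%R.
Hypothesis weight_ge0 : forall x, (0 <= weight x)%R.
Hypothesis weight_flip : forall x, weight (flip x) = weight x.
Hypothesis skew : forall s x,
  (alive s x * weight x = alive s (flip (flow s x)) * weight (flow s x))%R.
Hypothesis M_flip : forall h, nnmeas h -> \int[M]_x h (flip x) = \int[M]_x h x.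
Hypothesis M_flow : forall s h, nnmeas h -> \int[M]_x h (flow s x) = \int[M]_x h x.

Local Notation leb := (@lebesgue_measure R).
Implicit Types (f g : E -> \bar R) (F G : R * E -> \bar R) (r s t : R).

(** Space-time function: [killed f (t, x)] is the expectation of [f] at time
    [t] on the event that no jump has occurred. *)
Definition killed f (p : R * E) : \bar R := (alive p.1 p.2)%:E * f (flow p.1 p.2).

(** If [G (t, x)] is an expectation over a time interval of length [t] started
    from [x], then [jump G] is the same expectation with one jump made
    beforehand. *)
Definition jump G (p : R * E) : \bar R :=
  \int[leb]_s ((alive s p.2 * rate (flow s p.2))%:E * G ((p.1 - s)%R, flip (flow s p.2))).

(** The part of the semigroup carried by the event that exactly [n] jumps occur
    up to time [t]. *)
Definition njumps n f := iter n jump (killed f).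

(** The jump operator without the motion. *)
Let turn f x := (rate x)%:E * f (flip x).

(** The scalar product twisted by the flip. The killed flow and the jump
    operator are both symmetric for it, whereas for the untwisted product the
    adjoint would run along the reversed flow. *)
Let tform f g := \int[M]_x ((weight x)%:E * f (flip x) * g x).

Ltac meas :=
  repeat match goal with
  | |- nnmeas (fun x => _ * _) => apply: nnmeasM
  | |- nnmeas (fun x => (_)%:E) => apply: nnmeas_EFin
  | |- nnmeas _ => assumption
  | H : nnmeas ?f |- nnmeas (fun x => ?f _) => apply: (nnmeas_comp H)
  | |- measurable_fun _ (fun x => flow _ _) => apply: (measurable_pair_comp mflow)
  | |- measurable_fun _ (fun x => alive _ _) => apply: (measurable_pair_comp malive)
  | |- measurable_fun _ (fun x => flip _) => apply: (measurableT_comp mflip)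
  | |- measurable_fun _ (fun x => rate _) => apply: (measurableT_comp mrate)
  | |- measurable_fun _ (fun x => weight _) => apply: (measurableT_comp mweight)
  | |- measurable_fun _ (fun x => (_, _)) => apply: measurable_fun_pair
  | |- measurable_fun _ (fun x => (_ - _)%R) => apply: measurable_funB
  | |- measurable_fun _ (fun x => (_ + _)%R) => apply: measurable_funD
  | |- measurable_fun _ (fun x => (_ * _)%R) => apply: measurable_funM
  | |- measurable_fun _ (fun x => x) => exact: measurable_id
  | |- measurable_fun _ (fun x => x.1) => exact: measurable_fst
  | |- measurable_fun _ (fun x => x.2) => exact: measurable_snd
  | |- measurable_fun _ (fun x => (x.1).1) => exact: (measurableT_comp measurable_fst measurable_fst)
  | |- measurable_fun _ (fun x => (x.1).2) => exact: (measurableT_comp measurable_snd measurable_fst)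
  | |- measurable_fun _ (fun x => (x.2).1) => exact: (measurableT_comp measurable_fst measurable_snd)
  | |- measurable_fun _ (fun x => (x.2).2) => exact: (measurableT_comp measurable_snd measurable_snd)
  | |- measurable_fun _ _ => solve [assumption | by []]
  | |- forall x, is_true (0 <= _)%R => by move=> ?; rewrite ?mulr_ge0
  end.

Lemma nnmeas_killed f : nnmeas f -> nnmeas (killed f).
Proof. by move=> nf; rewrite /killed; meas. Qed.

Lemma nnmeas_jump G : nnmeas G -> nnmeas (jump G).
Proof.
move=> nG.
suff nH: nnmeas (fun q : (R * E) * R => (alive q.2 q.1.2 * rate (flow q.2 q.1.2))%:E * G ((q.1.1 - q.2)%R, flip (flow q.2 q.1.2))).
exact: (nnmeas_integral leb nH).
meas.
Qed.

Lemma nnmeas_njumps n f : nnmeas f -> nnmeas (njumps n f).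
Proof. by move=> nf; elim: n => [|n IH]; [exact: nnmeas_killed|exact: nnmeas_jump]. Qed.

Let nnmeas_turn f : nnmeas f -> nnmeas (turn f).
Proof. by move=> nf; rewrite /turn; meas. Qed.

Let tformC f g : nnmeas f -> nnmeas g -> tform f g = tform g f.
Proof.
move=> nf ng; rewrite /tform -M_flip; last by meas.
by apply: eq_integral => x _; rewrite flipK weight_flip muleAC.
Qed.

(** The skew balance, integrated: substitute the end point of the trajectory
    for its starting point. *)
Let tform_killed s f g : nnmeas f -> nnmeas g ->
  tform f (fun x => killed g (s, x)) = tform (fun x => killed f (s, x)) g.
Proof.
move=> nf ng; rewrite /tform /killed/=.
pose h z := (weight z)%:E * ((alive s (flip z))%:E * f (flow s (flip z))) * g z.
rewrite -(M_flow s (h := h)); last by rewrite /h; meas.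
apply: eq_integral => x _; rewrite /h flow_flip_flow.
rewrite !muleA -!EFinM [in RHS]mulrC -skew mulrC.
by rewrite EFinM -!muleA; congr (_ * _); rewrite muleCA.
Qed.

Let tform_turn f g : nnmeas f -> nnmeas g -> tform f (turn g) = tform (turn f) g.
Proof.
move=> nf ng; rewrite tformC//; last exact: nnmeas_turn.
by apply: eq_integral => x _; rewrite /turn flipK !muleA [LHS]muleAC.
Qed.

Let nnmeas_section G r : nnmeas G -> nnmeas (fun x => G (r, x)).
Proof. by move=> nG; meas. Qed.

Let nnmeas_tform d' (U : measurableType d') (F G : U * E -> \bar R) :
  nnmeas F -> nnmeas G ->
  nnmeas (fun u => tform (fun x => F (u, x)) (fun x => G (u, x))).
Proof.
move=> nF nG.
have nH : nnmeas (fun p : U * E => (weight p.2)%:E * F (p.1, flip p.2) * G (p.1, p.2)).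
  by meas.
exact: (nnmeas_integral M nH).
Qed.

Let tform_integral f (G : R * E -> \bar R) : nnmeas f -> nnmeas G ->
  tform f (fun x => \int[leb]_s G (s, x)) = \int[leb]_s tform f (fun x => G (s, x)).
Proof.
move=> nf nG.
have nH : nnmeas (fun p : E * R => (weight p.1)%:E * f (flip p.1) * G (p.2, p.1)) by meas.
transitivity (\int[M]_x \int[leb]_s ((weight x)%:E * f (flip x) * G (s, x))).
  apply: eq_integral => x _; rewrite ge0_integralZl//.
  - by have [mGx _] : nnmeas (fun s : R => G (s, x)) by meas.
  - by move=> s _; have [] := nG.
  - by rewrite mule_ge0 ?lee_fin//; have [] := nf.
exact: (nnmeas_swap M leb nH).
Qed.

(** Convolution in time of two space-time functions, paired through the jump
    operator. *)
Let conv F G t := \int[leb]_r tform (fun x => F ((t - r)%R, x)) (turn (fun x => G (r, x))).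

Let killed_turnE G r s x : killed (turn (fun x => G (r, x))) (s, x) =
  (alive s x * rate (flow s x))%:E * G (r, flip (flow s x)).
Proof. by rewrite /killed /turn EFinM muleA. Qed.

Let nnmeas_killed_turn d' (U : measurableType d') (u v : U -> R) (w : U -> E) G :
  nnmeas G -> measurable_fun [set: U] u -> measurable_fun [set: U] v ->
  measurable_fun [set: U] w ->
  nnmeas (fun p => killed (turn (fun x => G (u p, x))) (v p, w p)).
Proof.
move=> nG mu mv mw.
have H : nnmeas (fun p => (alive (v p) (w p) * rate (flow (v p) (w p)))%:E * G (u p, flip (flow (v p) (w p)))).
  by meas.
by move: H; congr nnmeas; apply/funext => p; rewrite killed_turnE.
Qed.

Let nnmeas_turn2 G : nnmeas G -> nnmeas (fun p : R * E => turn (fun x => G (p.1, x)) p.2).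
Proof. by move=> nG; rewrite /turn; meas. Qed.

Let nnmeas_conv F G t : nnmeas F -> nnmeas G ->
  nnmeas (fun r => tform (fun x => F ((t - r)%R, x)) (turn (fun x => G (r, x)))).
Proof.
move=> nF nG.
have nFt : nnmeas (fun p : R * E => F ((t - p.1)%R, p.2)) by meas.
exact: (nnmeas_tform nFt (nnmeas_turn2 nG)).
Qed.

Let conv_reflect F G t : nnmeas F -> nnmeas G ->
  conv F G t = \int[leb]_s tform (fun x => F (s, x)) (turn (fun x => G ((t - s)%R, x))).
Proof.
move=> nF nG; have [mH H0] := nnmeas_conv t nF nG.
rewrite /conv -(ge0_integral_reflect t mH H0).
by apply: eq_integral => s _; rewrite subKr.
Qed.

Let tform_jump f G t : nnmeas f -> nnmeas G ->
  tform f (fun x => jump G (t, x)) = conv (killed f) G t.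
Proof.
move=> nf nG; rewrite (conv_reflect t (nnmeas_killed nf) nG).
transitivity (tform f (fun x => \int[leb]_s killed (turn (fun y => G ((t - s)%R, y))) (s, x))).
  congr (tform f _); apply/funext => x; apply: eq_integral => s _.
  by rewrite killed_turnE.
have nK : nnmeas (fun p : R * E => killed (turn (fun y => G ((t - p.1)%R, y))) (p.1, p.2)).
  by apply: nnmeas_killed_turn => //; meas.
rewrite (tform_integral nf nK); apply: eq_integral => s _.
apply: (@tform_killed s f (turn (fun y => G ((t - s)%R, y)))) => //.
by apply: nnmeas_turn; meas.
Qed.

Let convC F G t : nnmeas F -> nnmeas G -> conv F G t = conv G F t.
Proof.
move=> nF nG; rewrite (conv_reflect t nF nG); apply: eq_integral => s _.
rewrite tform_turn; [|by meas|by meas].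
by rewrite tformC//; [apply: nnmeas_turn; meas|meas].
Qed.

(** Associativity of the convolution: the killed flow standing between [F] and
    [G] may be attached to either of them. In the double integral over the
    intermediate times, exchange the order of integration and translate. *)
Let conv_jump F G t : nnmeas F -> nnmeas G ->
  conv F (jump G) t = conv (jump F) G t.
Proof.
move=> nF nG.
(* [r] is the time left for [jump G] and [s] the time left for [G] after a flow
   segment of length [r - s]. *)
pose K r s x := killed (turn (fun y => F ((t - r)%R, y))) ((r - s)%R, x).
pose W s := turn (fun x => G (s, x)).
have nW s : nnmeas (W s) by apply: nnmeas_turn; meas.
transitivity (\int[leb]_r \int[leb]_s tform (K r s) (W s)).
  apply: eq_integral => r _.
  rewrite tform_turn; [|by meas|apply: nnmeas_section; exact: nnmeas_jump].
  by rewrite tform_jump//; apply: nnmeas_turn; meas.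
have nKW : nnmeas (fun p : R * R => tform (K p.1 p.2) (W p.2)).
  have nK : nnmeas (fun p : (R * R) * E => K p.1.1 p.1.2 p.2).
    by apply: nnmeas_killed_turn => //; meas.
  have nW2 : nnmeas (fun p : (R * R) * E => W p.1.2 p.2) by rewrite /W /turn; meas.
  exact: (nnmeas_tform nK nW2).
rewrite (nnmeas_swap leb leb nKW); apply: eq_integral => s _.
have [mK K0] : nnmeas (fun r => tform (K r s) (W s)).
  by apply: (nnmeas_comp nKW (g := fun r => (r, s))); meas.
rewrite -(ge0_integral_translate s mK K0).
transitivity (\int[leb]_r tform (W s) (fun x => killed (turn (fun y => F ((t - s - r)%R, y))) (r, x))).
  apply: eq_integral => r _; rewrite /K addrK (_ : t - (r + s) = t - s - r)%R; last by ring.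
  by rewrite tformC//; apply: nnmeas_killed_turn => //; meas.
have nK : nnmeas (fun p : R * E => killed (turn (fun y => F ((t - s - p.1)%R, y))) (p.1, p.2)).
  by apply: nnmeas_killed_turn => //; meas.
rewrite -(tform_integral (nW s) nK).
have nJF := nnmeas_jump nF.
transitivity (tform (W s) (fun x => jump F ((t - s)%R, x))); last by rewrite tformC//; meas.
congr (tform _ _); apply/funext => x; apply: eq_integral => r _.
by rewrite killed_turnE.
Qed.

Let conv_iter_jump n F G t : nnmeas F -> nnmeas G ->
  conv F (iter n jump G) t = conv (iter n jump F) G t.
Proof.
elim: n F => [|n IH] F nF nG; first reflexivity.
have nIG : nnmeas (iter n jump G) by elim: n {IH} => // n; exact: nnmeas_jump.
by rewrite iterS (conv_jump t nF nIG) (IH _ (nnmeas_jump nF) nG) -iterSr.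
Qed.

(** Splitting off the first jump writes the left-hand side as the convolution
    of [killed f] with [njumps n g]; the remaining jumps are carried over one
    by one to [f], and the commutativity of the convolution allows the first
    step to be undone with the roles of [f] and [g] exchanged. *)
Lemma njumps_dual n t f g : nnmeas f -> nnmeas g ->
  \int[M]_x ((weight x)%:E * f (flip x) * njumps n g (t, x)) =
  \int[M]_x ((weight x)%:E * njumps n f (t, flip x) * g x).
Proof.
move=> nf ng; rewrite -/(tform f (fun x => njumps n g (t, x))).
rewrite -/(tform (fun x => njumps n f (t, x)) g).
case: n => [|n]; first by rewrite tform_killed.
rewrite tform_jump//; last exact: nnmeas_njumps.
rewrite conv_iter_jump; [|exact: nnmeas_killed|exact: nnmeas_killed].
rewrite convC; [|exact: (nnmeas_njumps n nf)|exact: nnmeas_killed].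
rewrite -tform_jump//; last exact: (nnmeas_njumps n nf).
rewrite tformC//; apply: nnmeas_section; exact: (nnmeas_njumps n.+1 nf).
Qed.

End skew_duality.

(** * The jump chain of the zig-zag process and non-explosion *)

Section almost_sure.
Local Open Scope ereal_scope.
Context d (T : measurableType d) (R : realType).

(** Used to discard the null event on which some holding time is not positive:
    there the paths of a realization are not controlled. *)
Lemma ae_eq_measure (mu : {measure set T -> \bar R}) (A B : set T) :
  measurable A -> measurable B -> {ae mu, forall w, A w <-> B w} -> mu A = mu B.
Proof.
move=> mA mB AB; rewrite -[A]setIT -[B]setIT -!integral_indic//.
apply: ge0_ae_eq_integral => //.
- by apply/measurable_EFinP; exact: measurable_indic.
- by apply/measurable_EFinP; exact: measurable_indic.
apply: filterS AB => w AB _; rewrite !indicE; congr ((nat_of_bool _)%:R%:E).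
by apply/idP/idP => /set_mem /AB /mem_set.
Qed.

Lemma probability1_ae (P : probability T R) (A : set T) :
  measurable A -> P A = 1 -> {ae P, forall w, A w}.
Proof.
move=> mA PA; exists (~` A); split => //; first exact: measurableC.
by rewrite probability_setC// PA subee.
Qed.

End almost_sure.

Section process.
Context (R : realType) (a : R) (lambda : zzspace R -> R).
Hypothesis a_gt0 : 0 < a.
Hypothesis lambda_ge0 : forall x, 0 <= lambda x.
Hypothesis lambda_cont : continuous lambda.
Variable L : bool -> R -> R.
Hypothesis dL : forall j (y : R), is_derive y 1 (L j) (lambda (y, j)).
Variables (y0 lambda_min : R).
Hypothesis lambda_min_gt0 : 0 < lambda_min.
Hypothesis hi : forall (y : R) (j : bool), y0 <= sgn j * y -> lambda_min <= lambda (y, j).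

Local Notation flow := (zz_flow a).
Local Notation alive := (zz_alive a lambda).
Local Notation jump_density := (zz_jump_density a lambda).
Local Notation zz_jump := (jump (@zz_flip R) flow alive lambda).
Local Notation zz_njumps := (njumps (@zz_flip R) flow alive lambda).

Context (x : zzspace R) (X : zigzag a lambda x).
Local Notation Omega := (zz_Omega X).
Local Notation P := (zz_P X).
Local Notation Z := (zz_Z X).
Local Notation Tn := (jump_time Z).
Local Notation past n := (g_sigma_preimage (fun k : 'I_n => Z k : Omega -> R)).

Definition jump_dir n : bool := iter n negb x.2.

(** The position at the [n]-th jump as a function of the first [n] holding
    times alone, which makes its measurability with respect to the past
    evident; it is the actual position as soon as these holding times are
    positive ([zz_Y_jump_time]). *)
Definition jump_pos n (w : Omega) : R :=
  x.1 + \sum_(k < n) a * sgn (jump_dir k) * Z k w.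

Definition jump_state n w : zzspace R := (jump_pos n w, jump_dir n).

Lemma jump_timeS n w : Tn n.+1 w = Tn n w + Z n w.
Proof. by rewrite /jump_time big_ord_recr. Qed.

Lemma jump_time0 w : Tn 0 w = 0.
Proof. by rewrite /jump_time big_ord0. Qed.

Lemma jump_stateS n w : jump_state n.+1 w = zz_flip (flow (Z n w) (jump_state n w)).
Proof. by rewrite /jump_state /zz_flip /zz_flow/= /jump_pos big_ord_recr/= addrA. Qed.

Lemma jump_state0 w : jump_state 0 w = x.
Proof. by rewrite /jump_state /jump_pos big_ord0 addr0 [RHS]surjective_pairing. Qed.

Lemma zz_J_jump_time n w : zz_J X (Tn n w) w = jump_dir n.
Proof.
elim: n => [|n IH]; first by rewrite jump_time0 zz_J0.
by rewrite zz_J_jump IH.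
Qed.

Lemma zz_Y_jump_time n w : (forall k, (k < n)%N -> 0 < Z k w) ->
  zz_Y X (Tn n w) w = jump_pos n w.
Proof.
elim: n => [|n IH] Zpos; first by rewrite jump_time0 zz_Y0 /jump_pos big_ord0 addr0.
rewrite (@zz_Y_path _ _ _ _ X n); last first.
  by rewrite lexx andbT jump_timeS ltrDl Zpos.
rewrite IH; last by move=> k kn; apply: Zpos; exact: ltnW.
rewrite zz_J_jump_time jump_timeS (addrC _ (Z n w)) addrK.
by rewrite /jump_pos big_ord_recr/= addrA (mulrC a).
Qed.

Lemma jump_time_incr n w : (forall k, (k < n)%N -> 0 <= Z k w) -> 0 <= Tn n w.
Proof. by move=> Zpos; apply: sumr_ge0 => k _; exact: Zpos. Qed.

(** The speed is [a]. *)
Lemma jump_pos_dist n w : (forall k, (k < n)%N -> 0 < Z k w) ->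
  `|jump_pos n w - x.1| <= a * Tn n w.
Proof.
move=> Zpos; rewrite /jump_pos addrC addKr mulr_sumr.
apply: le_trans (ler_norm_sum _ _ _) _; apply: ler_sum => k _.
rewrite !normrM (gtr0_norm a_gt0) (gtr0_norm (Zpos k (ltn_ord k))).
suff -> : `|sgn (jump_dir k) : R| = 1 by rewrite mulr1.
by rewrite /sgn; case: ifP; rewrite ?normrN1 ?normr1.
Qed.

(** Between two jump times the path is the deterministic flow started at the
    last jump. The case [t = Tn n w] is separate because the path conditions
    speak of later times. *)
Lemma zz_state t n w : (forall k, 0 < Z k w) -> Tn n w <= t < Tn n.+1 w ->
  (zz_Y X t w, zz_J X t w) = flow (t - Tn n w) (jump_state n w).
Proof.
move=> Zpos /andP[]; rewrite /zz_flow/= le_eqVlt => /predU1P[<- _|Tt tT].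
  by rewrite subrr mulr0 addr0 zz_J_jump_time zz_Y_jump_time.
rewrite (@zz_J_between _ _ _ _ X n); last by rewrite Tt.
rewrite (@zz_Y_path _ _ _ _ X n); last by rewrite Tt ltW.
by rewrite zz_J_jump_time zz_Y_jump_time// (mulrC a).
Qed.

Lemma past_measurable n : past n `<=` measurable.
Proof.
apply: smallest_sub; first exact: sigma_algebra_measurable.
elim/big_ind: _ => //; first by move=> A B HA HB; rewrite subUset.
move=> k _ _ [B mB <-]; rewrite setTI -[X in measurable X]setTI.
exact: measurable_funP.
Qed.

Local Notation past_type n := (g_sigma_algebraType
  (\big[setU/set0]_(i < n) preimage_set_system setT (Z i : Omega -> R) measurable)).

Lemma past_measurable_fun n k : (k < n)%N ->
  measurable_fun [set: past_type n] (Z k : Omega -> R).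
Proof.
move=> kn _ B mB; rewrite setTI; apply: sub_sigma_algebra.
rewrite -(bigcup_mkord n (fun i => preimage_set_system setT (Z i : Omega -> R) measurable)).
by exists k => //; exists B => //; rewrite setTI.
Qed.

Lemma past_jump_state n (B : set (R * (R * bool))) : measurable B ->
  past n ((fun w => (Tn n w, jump_state n w)) @^-1` B).
Proof.
move=> mB.
have mT : measurable_fun [set: past_type n] (Tn n).
  apply: measurable_sum => k; exact: past_measurable_fun.
have mX : measurable_fun [set: past_type n] (jump_pos n).
  apply: measurable_funD => //; apply: measurable_sum => k.
  by apply: measurable_funM => //; exact: past_measurable_fun.
have mV : measurable_fun [set: past_type n] (fun w => (Tn n w, jump_state n w)).
  by apply: measurable_fun_pair => //; apply: measurable_fun_pair.
by have := mV measurableT B mB; rewrite setTI.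
Qed.

Let mjump_density : measurable_fun [set: R * (R * bool)] (fun p => jump_density p.1 p.2).
Proof. exact: measurable_jump_density. Qed.

Let malive : measurable_fun [set: R * (R * bool)] (fun p => alive p.1 p.2).
Proof. exact: measurable_alive. Qed.

Let mflow : measurable_fun [set: R * (R * bool)] (fun p => flow p.1 p.2).
Proof. exact: measurable_flow. Qed.

Let alive_ge0' s z : 0 <= alive s z. Proof. exact: alive_ge0. Qed.

Let jump_density_ge0' s z : 0 <= jump_density s z. Proof. exact: jump_density_ge0. Qed.

Lemma measurable_holding_gt n (t : R) : measurable [set w | t < Z n w].
Proof.
rewrite (_ : [set w | _] = (Z n) @^-1` `]t, +oo[).
  by rewrite -[X in measurable X]setTI; exact: measurable_funP.
by apply/seteqP; split => w /=; rewrite in_itv/= andbT.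
Qed.

Lemma holding_gt0 n : P [set w | 0 < Z n w] = 1%E.
Proof.
have [_ /(_ setT)] := zz_Z_law X n (lexx 0).
rewrite setIT => -> //; last first.
  by rewrite -setC0; apply: sigma_algebraC; exact: sigma_algebra0.
under eq_integral do rewrite survival0.
by rewrite integral_cst// mul1e; exact: (probability_setT P).
Qed.

Lemma ae_holding_gt0 : {ae P, forall w, forall n, 0 < Z n w}.
Proof.
apply: ae_foralln => n; apply: probability1_ae (holding_gt0 n).
exact: measurable_holding_gt.
Qed.

Lemma measurable_jump_time n : measurable_fun [set: Omega] (Tn n).
Proof. by apply: measurable_sum => k; exact: measurable_funP. Qed.

Lemma measurable_jump_time_le n (t : R) : measurable [set w | Tn n w <= t].
Proof.
rewrite (_ : [set w | _] = (Tn n) @^-1` `]-oo, t]).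
  by rewrite -[X in measurable X]setTI; exact: measurable_jump_time.
by apply/seteqP; split => w /=; rewrite in_itv.
Qed.

Lemma measurable_jump_time_gt n (t : R) : measurable [set w | t < Tn n w].
Proof.
rewrite (_ : [set w | _] = (Tn n) @^-1` `]t, +oo[).
  by rewrite -[X in measurable X]setTI; exact: measurable_jump_time.
by apply/seteqP; split => w /=; rewrite in_itv/= andbT.
Qed.

Lemma measurable_jump_times_bounded (t : R) : measurable [set w | forall n, Tn n w <= t].
Proof.
rewrite (_ : [set w | _] = \bigcap_n [set w | Tn n w <= t]).
  by apply: bigcapT_measurable => n; exact: measurable_jump_time_le.
by apply/seteqP; split => w Nw n; [move=> _|]; exact: Nw.
Qed.

Lemma measurable_jump_state n : measurable_fun [set: Omega] (jump_state n).
Proof.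
apply: measurable_fun_pair => //; apply: measurable_funD => //.
by apply: measurable_sum => k; apply: measurable_funM => //; exact: measurable_funP.
Qed.

(** For [t >= 0] this is the law prescribed by the realization; for negative
    [t] both sides are the probability of [C], because the holding time is
    almost surely positive. *)
Lemma holding_tail n C (t : R) : past n C ->
  P ([set w | t < Z n w] `&` C) =
  (\int[P]_(w in C) \int[lebesgue_measure]_(s in `]t, +oo[) (jump_density s (jump_state n w))%:E)%E.
Proof.
move=> SC; have mC := past_measurable SC.
under eq_integral do rewrite (integral_jump_density a_gt0 lambda_ge0 lambda_cont dL lambda_min_gt0 hi).
have [t0|t0] := leP 0 t.
  have [mG ->//] := zz_Z_law X n t0.
  apply: ge0_ae_eq_integral => //.
  - apply/measurable_EFinP; apply: measurable_funTS => _ B mB; rewrite setTI.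
    by apply: (@past_measurable n); exact: mG.
  - apply/measurable_EFinP; apply: measurable_funTS.
    apply: (measurable_pair_comp malive) => //; exact: measurable_jump_state.
  - by move=> w _; rewrite lee_fin expR_ge0.
  - by move=> w _; rewrite lee_fin.
  apply: filterS ae_holding_gt0 => w Zpos _.
  by rewrite /zz_alive t0 zz_J_jump_time zz_Y_jump_time.
under eq_integral do rewrite /zz_alive lexx survival0.
rewrite integral_cst// mul1e; apply: ae_eq_measure => //.
  by apply: measurableI => //; exact: measurable_holding_gt.
apply: filterS ae_holding_gt0 => w Zpos; split => [[]//|Cw]; split => //=.
exact: lt_trans (Zpos n).
Qed.

Lemma holding_step n (h : (R * zzspace R) * R -> \bar R) : nnmeas h ->
  (\int[P]_w h ((Tn n w, jump_state n w), Z n w) =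
   \int[P]_w \int[lebesgue_measure]_s
     (h ((Tn n w, jump_state n w), s) * (jump_density s (jump_state n w))%:E))%E.
Proof.
move=> [mh h0].
apply: (ge0_integral_conditional_density (S := past n)
  (V := fun w => (Tn n w, jump_state n w)) (k := fun p => jump_density p.2 p.1.2)) => //.
- exact: past_measurable.
- exact: past_jump_state.
- apply: (measurable_pair_comp mjump_density) => //.
  exact: (measurableT_comp measurable_snd measurable_fst).
- by move=> C t; exact: holding_tail.
Qed.

Let nnmeas_jump' G : nnmeas G -> nnmeas (zz_jump G).
Proof.
apply: nnmeas_jump => //; [exact: measurable_flip|exact: measurable_lambda].
Qed.

(** One step of the jump chain: condition on the past and integrate over the
    law of the next holding time. *)
Lemma integral_jumpS n t G : nnmeas G ->
  (\int[P]_w G ((t - Tn n.+1 w)%R, jump_state n.+1 w) =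
   \int[P]_w zz_jump G ((t - Tn n w)%R, jump_state n w))%E.
Proof.
move=> nG.
pose h (p : (R * zzspace R) * R) := G (t - (p.1.1 + p.2), zz_flip (flow p.2 p.1.2)).
have nh : nnmeas h.
  apply: (nnmeas_comp nG); apply: measurable_fun_pair.
    apply: measurable_funB => //; apply: measurable_funD => //.
    exact: (measurableT_comp measurable_fst measurable_fst).
  apply: (measurableT_comp (@measurable_flip R)); apply: (measurable_pair_comp mflow) => //.
  exact: (measurableT_comp measurable_snd measurable_fst).
transitivity (\int[P]_w h ((Tn n w, jump_state n w), Z n w))%E.
  by apply: eq_integral => w _; rewrite /h/= jump_timeS jump_stateS.
rewrite (holding_step n nh); apply: eq_integral => w _; apply: eq_integral => s _.
by rewrite muleC /h/= opprD addrA.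
Qed.

Lemma integral_jump_state n t G : nnmeas G ->
  (\int[P]_w G ((t - Tn n w)%R, jump_state n w) = iter n zz_jump G (t, x))%E.
Proof.
elim: n G => [|n IH] G nG.
  under eq_integral do rewrite jump_time0 subr0 jump_state0.
  by rewrite integral_cst//= -[RHS]mule1; congr (_ * _)%E; exact: (probability_setT P).
by rewrite integral_jumpS// IH -?iterSr//; exact: nnmeas_jump'.
Qed.

(** Given the past at the [n]-th jump time, the next jump comes after [t] with
    the probability that the particle survives for the remaining time; this is
    the survival weight in [killed], and the [n] earlier jumps are accounted
    for by [integral_jump_state]. *)
Lemma prob_njumps n t (A : set (zzspace R)) : measurable A ->
  P [set w | Tn n w <= t < Tn n.+1 w /\ A (flow (t - Tn n w) (jump_state n w))] =
  zz_njumps n (EFin \o \1_A) (t, x).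
Proof.
move=> mA.
pose D := [set p : (R * zzspace R) * R |
  p.1.1 <= t < p.1.1 + p.2 /\ A (flow (t - p.1.1) p.1.2)].
have mD : measurable D.
  rewrite (_ : D = [set p | (p.1.1 <= t) && (t < p.1.1 + p.2)] `&`
      (fun p => flow (t - p.1.1) p.1.2) @^-1` A); last by [].
  have mT : measurable_fun [set: (R * zzspace R) * R] (fun p => p.1.1).
    exact: (measurableT_comp measurable_fst measurable_fst).
  apply: measurableI.
    rewrite -[X in measurable X]setTI.
    apply: (@measurable_and _ _ _ (fun p : (R * zzspace R) * R => p.1.1 <= t)
      (fun p => t < p.1.1 + p.2) _ _ measurableT [set true]) => //.
      by apply: measurable_fun_ler.
    by apply: measurable_fun_ltr => //; exact: measurable_funD.
  rewrite -[X in measurable X]setTI.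
  suff : measurable_fun [set: (R * zzspace R) * R] (fun p => flow (t - p.1.1) p.1.2) by exact.
  apply: (measurable_pair_comp mflow); first exact: measurable_funB.
  exact: (measurableT_comp measurable_snd measurable_fst).
have nA : nnmeas (EFin \o \1_A : zzspace R -> \bar R).
  by apply: nnmeas_EFin => //; exact: measurable_indic.
have nD : nnmeas (EFin \o \1_D : (R * zzspace R) * R -> \bar R).
  by apply: nnmeas_EFin => //; exact: measurable_indic.
rewrite /njumps -integral_jump_state; last exact: nnmeas_killed.
have mE : measurable [set w | Tn n w <= t < Tn n.+1 w /\ A (flow (t - Tn n w) (jump_state n w))].
  rewrite (_ : [set w | _] = (fun w => ((Tn n w, jump_state n w), Z n w)) @^-1` D).
    rewrite -[X in measurable X]setTI.
    suff : measurable_fun [set: Omega] (fun w => ((Tn n w, jump_state n w), Z n w)) by exact.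
    apply: measurable_fun_pair; last exact: measurable_funP.
    by apply: measurable_fun_pair; [exact: measurable_jump_time|exact: measurable_jump_state].
  by apply/seteqP; split => w; rewrite /D/= jump_timeS.
rewrite -[in LHS](setIT [set w | _]) -integral_indic//.
transitivity (\int[P]_w (EFin \o \1_D) ((Tn n w, jump_state n w), Z n w))%E.
  apply: eq_integral => w _ /=; rewrite !indicE; congr ((nat_of_bool _)%:R%:E).
  by apply/idP/idP => /set_mem Ew; apply/mem_set; move: Ew; rewrite /D/= jump_timeS.
rewrite (holding_step n nD); apply: eq_integral => w _.
rewrite /killed/=.
have [Tt|tT] := leP (Tn n w) t; last first.
  rewrite {1}/zz_alive subr_ge0 leNgt tT/= mul0e integral0_eq// => s _.
  by rewrite indicE memNset ?mul0e// /D/= leNgt tT/= => -[].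
transitivity (\int[lebesgue_measure]_(s in `](t - Tn n w)%R, +oo[)
   ((jump_density s (jump_state n w))%:E * (\1_A (flow (t - Tn n w) (jump_state n w)))%:E))%E.
  rewrite [RHS]integral_mkcond; apply: eq_integral => s _.
  rewrite patchE; case: ifPn => [/set_mem|/negP]; rewrite /= ?in_itv/= ?andbT => ts.
    rewrite muleC; congr (_ * _)%E; rewrite !indicE; congr ((nat_of_bool _)%:R%:E).
    apply/idP/idP => /set_mem; rewrite /D/= => E; apply/mem_set => //=; first by case: E.
    by rewrite Tt -ltrBlDl.
  rewrite indicE memNset ?mul0e// /D/= => -[/andP[_ Hs] _]; apply: ts.
  by apply/mem_set; rewrite /= in_itv/= andbT ltrBlDl.
rewrite ge0_integralZr//.
- by rewrite (integral_jump_density a_gt0 lambda_ge0 lambda_cont dL lambda_min_gt0 hi) max_r// subr_ge0.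
- apply: measurable_funTS; apply/measurable_EFinP.
  by apply: (measurable_pair_comp mjump_density).
- by move=> s _; rewrite lee_fin.
Qed.

(** With [H r = exp (c (r - t))] for [r >= 0] and 0 otherwise, [H (t - T_n)] is
    [exp (- c T_n)] on the event that [T_n <= t]. On that event the particle is
    at distance at most [a * t] from its starting point, where the rate is
    bounded by [M]; averaging over one more holding time therefore multiplies
    the expectation by at most [M / c]. With [c = 2 M] the expectations
    decrease geometrically, whereas they stay above [exp (- c t)] times the
    probability that all jump times are at most [t]. *)
Lemma jump_times_unbounded (t : R) : 0 <= t ->
  P [set w | forall n, Tn n w <= t] = 0%E.
Proof.
move=> t0; have [M M0 MP] := lambda_bounded lambda_cont x.1 (a * t).
pose c : R := 2 * M; have c0 : 0 < c by rewrite mulr_gt0.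
pose H (r : R) : R := if 0 <= r then expR (c * (r - t)) else 0.
have H0 r : 0 <= H r by rewrite /H; case: ifP => // _; exact: expR_ge0.
have mH : measurable_fun [set: R] H.
  apply: measurable_fun_ifT => //; first exact: measurable_fun_ler.
  apply: measurableT_comp => //; apply: measurable_funM => //; exact: measurable_funB.
pose G (p : R * zzspace R) := ((H p.1)%:E * (if (`|p.2.1 - x.1| <= a * t)%R then 1 else 0))%E : \bar R.
have nG : nnmeas G.
  apply: nnmeasM.
    by apply: nnmeas_EFin => //; exact: (measurableT_comp mH measurable_fst).
  split; last by move=> p; case: ifP.
  apply: measurable_fun_ifT => //; apply: measurable_fun_ler => //.
  apply: measurableT_comp => //; apply: measurable_funB => //.
  exact: (measurableT_comp measurable_fst measurable_snd).
have mHE : measurable_fun [set: R] (fun r => (H r)%:E) by exact/measurable_EFinP.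
have mHT n : measurable_fun [set: Omega] (fun w => (H (t - Tn n w))%:E).
  apply: (measurableT_comp mHE); apply: measurable_funB => //.
  exact: measurable_jump_time.
(* One jump from anywhere into the region where the rate is at most [M] gains a
   factor M / c = 1/2. *)
have jumpG r z : (zz_jump G (r, z) <= 2^-1%:E * (H r)%:E)%E.
  have -> : (2^-1%:E * (H r)%:E = (M * H r)%:E *
      \int[lebesgue_measure]_(s in `[0%R, +oo[) (expR (- (c * s)))%:E)%E.
    by rewrite integral_expR_decay// -!EFinM; congr EFin; rewrite /c; field; rewrite gt_eqF.
  have mexp : measurable_fun [set: R] (fun s => (expR (- (c * s)))%:E).
    apply/measurable_EFinP; apply: measurableT_comp => //.
    by apply: measurable_funN; exact: measurable_funM.
  rewrite -ge0_integralZl//; last 2 first.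
  - exact: measurable_funTS.
  - by rewrite lee_fin mulr_ge0// ltW.
  rewrite [leRHS]integral_mkcond; apply: ge0_le_integral => //.
  - move=> s _; apply: mule_ge0; first by rewrite lee_fin jump_density_ge0'.
    by have [_] := nG; exact.
  - apply: emeasurable_funM.
      apply/measurable_EFinP; exact: (measurable_pair_comp mjump_density).
    have [mG _] := nG; apply: (measurableT_comp mG); apply: measurable_fun_pair.
      exact: measurable_funB.
    apply: (measurableT_comp (@measurable_flip R)); exact: (measurable_pair_comp mflow).
  - apply/(measurable_restrictT _ _).1 => //; apply: emeasurable_funM => //.
    exact: measurable_funTS.
  move=> s _; rewrite patchE; have [s0|s0] := ltP s 0.
    have -> : alive s z = 0 by rewrite /zz_alive leNgt s0.
    rewrite mul0r mul0e.
    by case: ifP => // _; rewrite mule_ge0// lee_fin ?expR_ge0// mulr_ge0// ltW.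
  rewrite mem_set/=; last by rewrite in_itv/= s0.
  rewrite /G/=; case: ifP => [zb|_]; last first.
    by rewrite !mule0 -EFinM lee_fin mulr_ge0 ?expR_ge0// mulr_ge0// ltW.
  rewrite mule1 -!EFinM lee_fin.
  have Hrs : H (r - s) <= H r * expR (- (c * s)).
    rewrite {1}/H; case: ifP => [rs|_]; last by rewrite mulr_ge0// expR_ge0.
    rewrite /H ifT; last by rewrite (le_trans s0)// -subr_ge0.
    by rewrite -expRD ler_expR le_eqVlt; apply/orP; left; apply/eqP; ring.
  have MH : 0 <= M * (H r * expR (- (c * s))).
    by rewrite mulr_ge0 ?(ltW M0)// mulr_ge0// expR_ge0.
  rewrite -mulrA -mulrA; apply: le_trans (ler_piMl MH (alive_le1 a lambda_ge0 s z)).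
  apply: ler_wpM2l => //; apply: ler_pM => //; exact: MP.
(* Restricting to positions within distance [a * t] changes nothing, almost
   surely. *)
have HG n : (\int[P]_w (H (t - Tn n w))%:E = \int[P]_w G ((t - Tn n w)%R, jump_state n w))%E.
  apply: ge0_ae_eq_integral => //.
  - have [mG _] := nG; apply: (measurableT_comp mG); apply: measurable_fun_pair.
      by apply: measurable_funB => //; exact: measurable_jump_time.
    exact: measurable_jump_state.
  - by move=> w _; rewrite lee_fin.
  - by move=> w _; have [_] := nG; exact.
  apply: filterS ae_holding_gt0 => w Zpos _; rewrite /G/=.
  case: ifPn => [_|]; first by rewrite mule1.
  rewrite -ltNge mule0 => far; congr EFin; rewrite /H ifF//; apply/negbTE.
  rewrite subr_ge0 -ltNge -(ltr_pM2l a_gt0); apply: lt_le_trans far _.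
  exact: jump_pos_dist.
have u_le n : (\int[P]_w (H (t - Tn n w))%:E <= ((2^-1)^+n)%:E)%E.
  elim: n => [|n IH].
    under eq_integral do rewrite jump_time0 subr0 /H t0 subrr mulr0 expR0.
    rewrite integral_cst// mul1e le_eqVlt; apply/orP; left; apply/eqP.
    exact: (probability_setT P).
  rewrite HG integral_jumpS// exprS EFinM.
  apply: le_trans (lee_wpmul2l _ IH); last by rewrite lee_fin invr_ge0.
  rewrite -ge0_integralZl//.
  apply: ge0_le_integral => //.
  - by move=> w _; have [_] := nnmeas_jump' nG; exact.
  - have [mJ _] := nnmeas_jump' nG; apply: (measurableT_comp mJ); apply: measurable_fun_pair.
      by apply: measurable_funB => //; exact: measurable_jump_time.
    exact: measurable_jump_state.
  - exact: measurable_funeM.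
  - by move=> w _; rewrite lee_fin.
pose N := [set w | forall n, Tn n w <= t].
have mN : measurable N by exact: measurable_jump_times_bounded.
have PN n : ((expR (- (c * t)))%:E * P N <= ((2^-1)^+n)%:E)%E.
  apply: le_trans (u_le n); rewrite -integral_cst// integral_mkcond.
  apply: ae_ge0_le_integral => //.
  - by move=> w _; rewrite patchE; case: ifP => // _; rewrite lee_fin expR_ge0.
  - by apply/(measurable_restrictT _ _).1.
  - by move=> w _; rewrite lee_fin.
  apply: filterS ae_holding_gt0 => w Zpos _; rewrite patchE.
  case: ifPn => [/set_mem Nw|_]; last by rewrite lee_fin.
  have Tt := Nw n; have T0 : 0 <= Tn n w by apply: jump_time_incr => k _; exact: ltW.
  rewrite lee_fin /H subr_ge0 Tt ler_expR addrAC subrr add0r mulrN lerN2.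
  by rewrite ler_pM2l.
have PNfin : P N \is a fin_num by exact: fin_num_measure.
apply/eqP; rewrite -/N eq_le measure_ge0 andbT leNgt; apply/negP => PN0.
have : 0 < expR (- (c * t)) * fine (P N).
  by rewrite mulr_gt0 ?expR_gt0// fine_gt0// PN0/= ltey_eq PNfin.
set q := _ * _ => q0.
have qn n : q <= (2^-1)^+n by have := PN n; rewrite -(fineK PNfin) -EFinM lee_fin.
have := archi_boundP (ltW (_ : 0 < q^-1)); rewrite invr_gt0 => /(_ q0).
set b := Num.bound _; rewrite ltNge => /negP; apply.
apply: (@le_trans _ _ (2 ^+ b)).
  by rewrite -natrX ler_nat ltnW// ltn_expl.
by rewrite -[2 ^+ b]invrK lef_pV2 ?qualifE/= ?invr_gt0 ?exprn_gt0// -exprVn.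
Qed.

(** Almost surely the jump times increase to infinity, so exactly one [n]
    satisfies [T_n <= t < T_(n+1)]. *)
Lemma zz_probE (t : R) (A : set (zzspace R)) : 0 <= t -> measurable A ->
  (zz_prob X t A = \sum_(n <oo) zz_njumps n (EFin \o \1_A) (t, x))%E.
Proof.
move=> t0 mA.
pose E n := [set w | Tn n w <= t < Tn n.+1 w /\ A (flow (t - Tn n w) (jump_state n w))].
pose O := [set w : Omega | forall n, 0 < Z n w].
pose B := [set w | A (zz_Y X t w, zz_J X t w)].
have mO : measurable O.
  rewrite (_ : O = \bigcap_n [set w | 0 < Z n w]).
    by apply: bigcapT_measurable => n; exact: measurable_holding_gt.
  by apply/seteqP; split => w Ow n; [move=> _|]; exact: Ow.
have mE n : measurable (E n).
  have mV : measurable_fun [set: Omega] (fun w => flow (t - Tn n w) (jump_state n w)).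
    apply: (measurable_pair_comp mflow); last exact: measurable_jump_state.
    by apply: measurable_funB => //; exact: measurable_jump_time.
  rewrite (_ : E n = [set w | Tn n w <= t] `&` [set w | t < Tn n.+1 w] `&`
      (fun w => flow (t - Tn n w) (jump_state n w)) @^-1` A).
    apply: measurableI; last by rewrite -[X in measurable X]setTI; exact: mV.
    by apply: measurableI; [exact: measurable_jump_time_le|exact: measurable_jump_time_gt].
  by apply/seteqP; split => w; rewrite /E/=; [move=> [/andP[-> ->]]|move=> [[-> ->]]].
have mB : measurable B.
  have mYJ : measurable_fun [set: Omega] (fun w => (zz_Y X t w, zz_J X t w)).
    by apply: measurable_fun_pair; exact: measurable_funP.
  by have := mYJ measurableT A mA; rewrite setTI.
have Tincr w : O w -> {homo (fun n => Tn n w) : m n / (m <= n)%N >-> m <= n}.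
  move=> Ow; apply: homo_leq; [exact: lexx|exact: le_trans|move=> n].
  by rewrite jump_timeS lerDl ltW.
have tE : trivIset setT (fun n => E n `&` O).
  apply/trivIsetP => m n _ _; wlog mn : m n / (m < n)%N.
    by move=> H; case: ltngtP => // mn _; [|rewrite setIC]; apply: H; rewrite ?ltn_eqF.
  move=> _; apply/seteqP; split => // w [[[/andP[_ tm] _] Ow] [[/andP[nt _] _] _]].
  by have := lt_le_trans tm (le_trans (Tincr w Ow _ _ mn) nt); rewrite ltxx.
transitivity (P (\bigcup_n (E n `&` O))).
  apply: ae_eq_measure => //.
    by apply: bigcupT_measurable => n; exact: measurableI.
  have aeT : {ae P, forall w, ~ forall n, Tn n w <= t}.
    exists [set w | forall n, Tn n w <= t]; split.
    - exact: measurable_jump_times_bounded.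
    - exact: jump_times_unbounded.
    - by move=> w /=; exact: contrapT.
  have := ae_holding_gt0; move: aeT; apply: filterS2 => w wT Ow; split; last first.
    by move=> [n _ [[Tt Aw] _]]; rewrite /B/= (zz_state Ow Tt).
  move=> Bw; have [n [Tn1 nmin]] : exists n, t < Tn n.+1 w /\ Tn n w <= t.
    have /existsNP[m /negP] := wT; rewrite -ltNge => tm.
    have ex : exists m, t < Tn m w by exists m.
    case: (ex_minnP ex) => -[|n] tn nmin; first by move: tn; rewrite jump_time0 ltNge t0.
    exists n; split => //; rewrite leNgt; apply/negP => /nmin.
    by rewrite ltnn.
  have Tt : Tn n w <= t < Tn n.+1 w by rewrite nmin.
  exists n => //; split => //; split => //.
  by rewrite -(zz_state Ow Tt).
rewrite measure_bigcup//; last by move=> n _; exact: measurableI.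
rewrite (eq_eseriesl (Q := xpredT)); last by move=> n; rewrite in_setT.
apply: eq_eseriesr => n _; rewrite -prob_njumps//.
apply: ae_eq_measure; [exact: measurableI|exact: mE|].
by apply: filterS ae_holding_gt0 => w Ow; split=> [[]//|Ew]; split.
Qed.

End process.

(** * The invariant measure *)

Section reference_measure.
Local Open Scope ereal_scope.
Context (R : realType).
Local Notation M := (@lebesgue_measure R \x @sign_measure R).
Implicit Types h : zzspace R -> \bar R.

(** Needed for the Tonelli theorem with the product measure as a factor. *)
Lemma reference_sigma_finite : sigma_finite [set: measurableTypeR R * bool] M.
Proof.
exists (fun n => `[(- n%:R)%R, n%:R] `*` setT).
  apply/esym/seteqP; split=> // -[y j] _; exists (Num.bound `|y|)%R => //; split => //=.
  rewrite in_itv/= -ler_norml; exact/ltW/archi_boundP.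
move=> n; split; first exact: measurableX.
rewrite product_measure1E//; apply: lte_mul_pinfty.
- exact: measure_ge0.
- suff : @lebesgue_measure R `[(- n%:R)%R, n%:R] \is a fin_num by exact.
  by rewrite lebesgue_measure_itv/=; case: ifP.
- by rewrite ltey_eq fin_num_measure.
Qed.

Definition reference_measure : {sigma_finite_measure set (measurableTypeR R * bool)%type -> \bar R} :=
  HB.pack M (@Measure_isSigmaFinite.Build _ _ R M reference_sigma_finite).

Lemma integral_sign_measure (f : bool -> \bar R) : (forall j, 0 <= f j) ->
  \int[@sign_measure R]_j f j = f false + f true.
Proof.
move=> f0; rewrite ge0_integral_measure_add// !integral_dirac//.
by rewrite !diracT !mul1e.
Qed.

Lemma integral_reference h : nnmeas h ->
  \int[M]_x h x = \int[@sign_measure R]_j \int[lebesgue_measure]_y h (y, j).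
Proof. by move=> [mh h0]; have := fubini_tonelli2 (m1 := @lebesgue_measure R) (m2 := @sign_measure R) h mh h0. Qed.

Lemma integral_flip h : nnmeas h -> \int[M]_x h (zz_flip x) = \int[M]_x h x.
Proof.
move=> nh; have nhf := nnmeas_comp nh (@measurable_flip R).
rewrite (integral_reference nhf) (integral_reference nh).
have phi0 j : 0 <= \int[@lebesgue_measure R]_y h (y, j).
  by apply: integral_ge0 => y _; have [_] := nh; exact.
rewrite (integral_sign_measure phi0).
by rewrite (integral_sign_measure (fun j => phi0 (~~ j))) addeC.
Qed.

(** In each direction the flow is a translation of the line. *)
Lemma integral_flow a s h : nnmeas h -> \int[M]_x h (zz_flow a s x) = \int[M]_x h x.
Proof.
move=> nh; have [mh h0] := nh.
have mf : measurable_fun [set: zzspace R] (zz_flow a s).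
  by apply: (measurable_pair_comp (measurable_flow a)).
rewrite (integral_reference (nnmeas_comp nh mf)) (integral_reference nh).
apply: eq_integral => j _; rewrite /zz_flow/=.
rewrite (ge0_integral_translate (a * sgn j * s) (f := fun y => h (y, j)))//.
by apply: (measurableT_comp mh); exact: measurable_fun_pair.
Qed.

End reference_measure.

Section density_on_line.
Context (R : realType) (k : zzspace R -> R).
Hypotheses (mk : measurable_fun [set: zzspace R] k) (k0 : forall x, 0 <= k x).
Local Notation M := (@lebesgue_measure R \x @sign_measure R)%E.

Let mid : measurable_fun [set: (measurableTypeR R * bool)%type]
  (id : measurableTypeR R * bool -> zzspace R).
Proof. by move=> _ B mB; rewrite setTI. Qed.

(** Lebesgue measure lives on a copy of the line that carries the same Borel
    sets under another display; the density is pushed forward to the line by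
    the identity. *)
Lemma exists_density : exists mu : {measure set (zzspace R) -> \bar R},
  forall f : zzspace R -> \bar R, nnmeas f ->
    (\int[mu]_x f x = \int[M]_x (f x * (k x)%:E))%E.
Proof.
pose D := density M mk k0.
exists (measure_function_pushforward__canonical__measure_function_Measure D mid) => f [mf f0].
have -> := ge0_integral_pushforward mid D measurableT mf (fun x _ => f0 x).
exact: ge0_integral_density.
Qed.

End density_on_line.

Section invariance.
Context (R : realType) (a : R) (lambda : zzspace R -> R).
Hypothesis a_gt0 : 0 < a.
Hypothesis lambda_ge0 : forall x, 0 <= lambda x.
Hypothesis lambda_cont : continuous lambda.
Variable L : bool -> R -> R.
Hypothesis dL : forall j (y : R), is_derive y 1 (L j) (lambda (y, j)).
Variables (y0 lambda_min : R).
Hypothesis lambda_min_gt0 : 0 < lambda_min.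
Hypothesis hi : forall (y : R) (j : bool), y0 <= sgn j * y -> lambda_min <= lambda (y, j).

Local Notation M := (@lebesgue_measure R \x @sign_measure R)%E.
Local Notation zz_njumps := (njumps (@zz_flip R) (zz_flow a) (zz_alive a lambda) lambda).
Local Notation weight := (fun x : zzspace R => boltzmann a L x.1).

Lemma measurable_weight : measurable_fun [set: zzspace R] weight.
Proof. exact: (measurableT_comp (measurable_boltzmann a dL) measurable_fst). Qed.

Lemma weight_ge0 x : 0 <= weight x. Proof. exact: expR_ge0. Qed.

Variable mu : {measure set (zzspace R) -> \bar R}.
Hypothesis muE : forall f : zzspace R -> \bar R, nnmeas f ->
  (\int[mu]_x f x = \int[M]_x (f x * (weight x)%:E))%E.

Lemma zz_measureE A : measurable A ->
  mu A = (\int[M]_(x in A) (weight x)%:E)%E.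
Proof.
move=> mA; rewrite -[A in LHS]setIT -integral_indic// muE.
  rewrite [RHS]integral_mkcond; congr (integral _ _ _); apply/funext => x.
  by rewrite epatch_indic /= muleC.
by apply: nnmeas_EFin => //; exact: measurable_indic.
Qed.

Variable X : forall x, zigzag a lambda x.

(** Duality with [f = 1] exchanges the indicator of [A] at time [t] with the
    total mass of the [n]-jump part started from the flipped points of [A]; the
    sum over [n] of these masses is the probability, under the realization
    started there, of the whole space. *)
Lemma zz_measure_invariant : zz_invariant X mu.
Proof.
move=> t A t0 mA.
have probE B x : measurable B ->
    zz_prob (X x) t B = (\sum_(n <oo) zz_njumps n (EFin \o \1_B) (t, x))%E.
  by move=> mB; rewrite (zz_probE a_gt0 lambda_ge0 lambda_cont dL lambda_min_gt0 hi).
have nind B : measurable B -> nnmeas (EFin \o \1_B : zzspace R -> \bar R).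
  by move=> mB; apply: nnmeas_EFin => //; exact: measurable_indic.
have nQ n B : measurable B -> nnmeas (fun x => zz_njumps n (EFin \o \1_B) (t, x)).
  move=> mB.
  have H : nnmeas (zz_njumps n (EFin \o \1_B)).
    apply: nnmeas_njumps => //.
    - exact: measurable_flip.
    - exact: measurable_flow.
    - exact: (measurable_alive a_gt0 lambda_cont dL).
    - exact: measurable_lambda.
    - exact: alive_ge0.
    - exact: nind.
  by apply: (nnmeas_comp H); exact: measurable_fun_pair.
have mprob : measurable_fun [set: zzspace R] (fun x => zz_prob (X x) t A).
  under eq_fun do rewrite (probE A _ mA).
  apply: ge0_emeasurable_sum => [n x _ _|n _].
    by have [_] := nQ n A mA; exact.
  by have [] := nQ n A mA.
split=> //.
have mwE : measurable_fun [set: zzspace R] (fun x => (weight x)%:E).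
  by apply/measurable_EFinP; exact: measurable_weight.
(* Non-explosion, read off from the realization started at [x]. *)
have total x : (\sum_(n <oo) zz_njumps n (EFin \o \1_setT) (t, x) = 1)%E.
  by rewrite -probE// /zz_prob (_ : [set w | _] = setT)//; exact: probability_setT.
have dual n : (\int[M]_x ((weight x)%:E * zz_njumps n (EFin \o \1_A) (t, x)) =
   \int[M]_(x in A) ((weight x)%:E * zz_njumps n (EFin \o \1_setT) (t, zz_flip x)))%E.
  transitivity (\int[M]_x ((weight x)%:E * (EFin \o \1_setT) (zz_flip x) *
      zz_njumps n (EFin \o \1_A) (t, x)))%E.
    by apply: eq_integral => x _; rewrite /= indicT mule1.
  transitivity (\int[M]_x ((weight x)%:E * zz_njumps n (EFin \o \1_setT) (t, zz_flip x) *
      (EFin \o \1_A) x))%E.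
    apply: (@njumps_dual _ _ R (reference_measure R) (@zz_flip R) (zz_flow a)
      (zz_alive a lambda) lambda weight).
    - exact: flipK.
    - exact: flow_flip_flow.
    - exact: measurable_flip.
    - exact: measurable_flow.
    - exact: (measurable_alive a_gt0 lambda_cont dL).
    - exact: measurable_lambda.
    - exact: measurable_weight.
    - exact: alive_ge0.
    - exact: lambda_ge0.
    - exact: weight_ge0.
    - by [].
    - exact: skew_balance.
    - exact: integral_flip.
    - exact: integral_flow.
    - exact: nind.
    - exact: nind.
  rewrite [RHS]integral_mkcond; congr (integral _ _ _); apply/funext => x.
  by rewrite epatch_indic.
rewrite zz_measureE// muE; last by split=> // x; exact: measure_ge0.
transitivity (\int[M]_x \sum_(n <oo) ((weight x)%:E * zz_njumps n (EFin \o \1_A) (t, x)))%E.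
  apply: eq_integral => x _; rewrite probE// muleC nneseriesZl//.
  by move=> n _; have [_] := nQ n A mA; exact.
rewrite integral_nneseries//; last 2 first.
- by move=> n; apply: emeasurable_funM => //; have [] := nQ n A mA.
- by move=> n x _; rewrite mule_ge0 ?lee_fin ?weight_ge0//; have [_] := nQ n A mA; exact.
under eq_eseriesr do rewrite dual.
rewrite -integral_nneseries//; last 2 first.
- move=> n; apply: measurable_funTS; apply: emeasurable_funM => //.
  by have [mQ _] := nnmeas_comp (nQ n setT measurableT) (@measurable_flip R).
- move=> n x _; rewrite mule_ge0 ?lee_fin ?weight_ge0//.
  by have [_] := nQ n setT measurableT; exact.
apply: eq_integral => x _; rewrite nneseriesZl ?total ?mule1//.
by move=> n _; have [_] := nQ n setT measurableT; exact.
Qed.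

End invariance.

Theorem proposition5 (R : realType) (a : R) (lambda : zzspace R -> R)
    (a_gt0 : 0 < a)
    (lambda_ge0 : forall x, 0 <= lambda x)
    (lambda_cont : continuous lambda)
    (y0 lambda_min : R) (y0_ge0 : 0 <= y0) (lambda_min_gt0 : 0 < lambda_min)
    (hi : forall (y : R) (j : bool), y0 <= sgn j * y -> lambda_min <= lambda (y, j))
    (hii : forall (y : R) (j : bool), y0 <= sgn j * y ->
       lambda (y, ~~ j) <= lambda (y, j)) :
  (exists m : R, forall y : R, (m%:E <= Psi a lambda y)%E) /\
  (forall y : R, (Psi a lambda y < +oo)%E) /\
  (exists mu : {measure set (zzspace R) -> \bar R},
     (forall A : set (zzspace R), measurable A ->
        mu A = (\int[lebesgue_measure \x sign_measure R]_(x in A)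
                  expeR (- Psi a lambda x.1))%E) /\
     (forall X : forall x, zigzag a lambda x, zz_invariant X mu)).
Proof.
have cl j : continuous (fun y => lambda (y, j)) by exact: lambda_cont1.
have [Lp [Lp0 dLp]] := continuous_has_primitive (cl true).
have [Lm [Lm0 dLm]] := continuous_has_primitive (cl false).
pose L (j : bool) := if j then Lp else Lm.
have L0 j : L j 0 = 0 by case: j.
have dL j (y : R) : is_derive y 1 (L j) (lambda (y, j)) by case: j.
have PE := PsiE a lambda_cont L0 dL.
split.
  have [m mP] := potential_bounded_below a_gt0 dL y0_ge0 hii.
  by exists m => y; rewrite PE lee_fin.
split; first by move=> y; rewrite PE ltry.
have [mu muE] := exists_density (measurable_weight a dL) (weight_ge0 a L).
exists mu; split.
  move=> A mA; rewrite (zz_measureE muE mA); congr (integral _ _ _); apply/funext => x.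
  by rewrite PE.
by move=> X; exact: (zz_measure_invariant a_gt0 lambda_ge0 lambda_cont dL lambda_min_gt0 hi muE).
Qed.
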